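(* Let $U$ be a polynomial-time uniformly-generated quantum circuit acting on $n$ qubits that consists of $poly(n)$ Hadamard gates and classical reversible gates (such as $X$, CNOT and Toffoli). Then from (the description of) $U$ one can efficiently (in classical polynomial time) construct an HC1Q circuit on $N=poly(n)$ qubits such that a postselection on some of its output qubits generates the state $U|0^n\rangle$. That is, one can compute in polynomial time a classical reversible circuit $C$ on $N=poly(n)$ bits, a set $S\subseteq\{1,\dots,N\}$ of $N-n$ qubits and a string $b\in\{0,1\}^{S}$ such that $$(\langle b|_S\otimes I)\,(H^{\otimes (N-1)}\otimes I)\,C\,(H^{\otimes (N-1)}\otimes I)\,|0^N\rangle = c\,U|0^n\rangle$$ for some nonzero scalar $c$, where $\langle b|_S$ acts on the qubits in $S$, the identity acts on the remaining $n$ qubits, and $U|0^n\rangle$ is regarded as a state of these remaining $n$ qubits.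
   Context: $H$ is the one-qubit Hadamard gate and $I$ the one-qubit identity. An HC1Q (Hadamard-classical circuit with one-qubit) circuit on $N$ qubits is the following: start from $|0^N\rangle$; apply $H^{\otimes(N-1)}\otimes I$ (Hadamard on every qubit except the last); apply coherently a polynomial-time uniformly-generated classical reversible circuit $C:\{0,1\}^N\to\{0,1\}^N$ (a circuit of polynomially many classical reversible gates such as $X$, CNOT, Toffoli on the $N$ wires, viewed as the permutation unitary $|w\rangle\mapsto|C(w)\rangle$); apply $H^{\otimes(N-1)}\otimes I$ again; finally measure all qubits in the computational basis. Postselecting on a set $S$ of output qubits with outcome $b$ means conditioning on the event, of nonzero probability, that the computational-basis measurement of the qubits in $S$ gives $b$; the state generated is the resulting normalized state of the remaining qubits. ''Polynomial-time uniformly-generated'' means that a classical description of the circuit can be computed by a deterministic classical polynomial-time algorithm. *)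

(* Defs.v *)
From HB Require Import structures.
From mathcomp Require Import all_boot all_order all_algebra all_fingroup.

Set Implicit Arguments.
Unset Strict Implicit.
Unset Printing Implicit Defensive.

Import Order.TTheory GRing.Theory Num.Theory.

(** * Deterministic polynomial time

    The machine model is a deterministic multi-stack machine: finitely many
    registers, each a stack of bits, driven by a fixed structured program.  Every
    executed instruction inspects or changes only the top bit of one register and
    costs one time unit.  A register is a one-sided tape and two registers make a
    two-sided one, so running times agree with those of multitape Turing machines
    up to constant factors. *)

Inductive prog : Type :=
| Skip
| Push of nat & bool
| Pop of nat
| Seq of prog & prog
| Case of nat & prog & prog & prog  (* register empty / top bit 0 / top bit 1 *)
| While of nat & prog.              (* loop as long as the register is nonempty *)

Definition store := nat -> seq bool.

Definition upd (s : store) (r : nat) (v : seq bool) : store :=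
  fun q => if q == r then v else s q.

(** [exec p s t s']: started in [s], [p] halts in [s'] after [t] steps. *)
Inductive exec : prog -> store -> nat -> store -> Prop :=
| ExecSkip s : exec Skip s 1 s
| ExecPush r b s : exec (Push r b) s 1 (upd s r (b :: s r))
| ExecPop r s : exec (Pop r) s 1 (upd s r (behead (s r)))
| ExecSeq p q s t s1 u s2 :
    exec p s t s1 -> exec q s1 u s2 -> exec (Seq p q) s (t + u) s2
| ExecCase r pn p0 p1 s t s1 :
    exec (match s r with
          | [::] => pn
          | false :: _ => p0
          | true :: _ => p1
          end) s t s1 ->
    exec (Case r pn p0 p1) s t.+1 s1
| ExecWhileStop r p s : s r = [::] -> exec (While r p) s 1 s
| ExecWhileStep r p s t s1 u s2 :
    s r <> [::] -> exec p s t s1 -> exec (While r p) s1 u s2 ->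
    exec (While r p) s (t + u).+1 s2.

(** Input in register 0, all other registers empty; output in register 0. *)
Definition init (w : seq bool) : store := upd (fun=> [::]) 0 w.

Definition polytime (A B : Type) (encA : A -> seq bool) (encB : B -> seq bool)
    (f : A -> B) : Prop :=
  exists p : prog, exists c k : nat, forall a : A,
    exists t : nat, exists s : store,
      [/\ exec p (init (encA a)) t s,
          t <= c * size (encA a) ^ k + c
        & s 0 = encB (f a)].

(** * Circuits *)

(** Besides X, CNOT and Toffoli, circuits may use any fixed finite set of further
    classical reversible gates; the empty set leaves exactly those three. *)
Record gateset := Gateset {
  extra :> finType;
  extra_arity : extra -> nat;
  extra_perm : forall g : extra, {perm (extra_arity g).-tuple bool}
}.

Section Circuits.
Variable G : gateset.

Inductive csym : Type := X | CNOT | Toffoli | Extra of G.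

Definition arity (s : csym) : nat :=
  match s with X => 1 | CNOT => 2 | Toffoli => 3 | Extra g => extra_arity g end.

Definition csym_act (s : csym) : (arity s).-tuple bool -> (arity s).-tuple bool :=
  match s return (arity s).-tuple bool -> (arity s).-tuple bool with
  | X => fun x => [tuple ~~ nth false x 0]
  | CNOT => fun x => [tuple nth false x 0; nth false x 1 (+) nth false x 0]
  | Toffoli => fun x =>
      [tuple nth false x 0; nth false x 1;
             nth false x 2 (+) (nth false x 0 && nth false x 1)]
  | Extra g => fun x => extra_perm g x
  end.

(** For CNOT and Toffoli the target is the last listed wire. *)
Record cgate (n : nat) := CGate {
  cg_sym : csym;
  cg_wires : (arity cg_sym).-tuple 'I_n;
  cg_uniq : uniq cg_wires
}.

Inductive qgate (n : nat) : Type := Had of 'I_n | Classical of cgate n.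

(** The head of the list is the gate applied first. *)
Definition ccircuit (n : nat) := seq (cgate n).
Definition qcircuit (n : nat) := seq (qgate n).

Definition cgate_act n (g : cgate n) (x : n.-tuple bool) : n.-tuple bool :=
  let y := csym_act [tuple of map (tnth x) (cg_wires g)] in
  [tuple if i \in cg_wires g then nth false y (index i (cg_wires g)) else tnth x i
    | i < n].

Definition crun n (C : ccircuit n) (x : n.-tuple bool) : n.-tuple bool :=
  foldl (fun y g => cgate_act g y) x C.

(** An HC1Q circuit on [hc_pred.+1] qubits, the last one being the qubit without
    Hadamards, with a postselection: [hc_post] holds [Some b] on a wire
    postselected with outcome [b] and [None] on a remaining wire. *)
Record hc1q_post := HC1QPost {
  hc_pred : nat;
  hc_circuit : ccircuit hc_pred.+1;
  hc_post : hc_pred.+1.-tuple (option bool)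
}.

Definition hc_qubits (h : hc1q_post) : nat := (hc_pred h).+1.

Definition postselected N (p : N.-tuple (option bool)) : {set 'I_N} :=
  [set i | isSome (tnth p i)].

End Circuits.

Arguments X {G}.
Arguments CNOT {G}.
Arguments Toffoli {G}.

(** * Amplitudes

    [K] is any algebraically closed field with a conjugation and a positive cone,
    for instance the complex numbers. *)

Section States.
Variable K : numClosedFieldType.
Local Open Scope ring_scope.

Definition state (n : nat) := {ffun n.-tuple bool -> K}.

Definition ket n (x : n.-tuple bool) : state n := [ffun y => (y == x)%:R].

Definition ket0 n : state n := ket [tuple of nseq n false].

Definition setbit n (x : n.-tuple bool) (i : 'I_n) (b : bool) : n.-tuple bool :=
  [tuple if j == i then b else tnth x j | j < n].

Definition hadamard n (i : 'I_n) (psi : state n) : state n :=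
  [ffun x => (sqrtC 2)^-1 *
     (psi (setbit x i false) + (-1) ^+ tnth x i * psi (setbit x i true))].

(** Linear extension of |w> |-> |f w>. *)
Definition apply_fun n (f : n.-tuple bool -> n.-tuple bool) (psi : state n) :
    state n :=
  [ffun x => \sum_(w | f w == x) psi w].

Definition qgate_apply (G : gateset) n (g : qgate G n) (psi : state n) : state n :=
  match g with
  | Had i => hadamard i psi
  | Classical h => apply_fun (cgate_act h) psi
  end.

Definition qrun (G : gateset) n (U : qcircuit G n) (psi : state n) : state n :=
  foldl (fun phi g => qgate_apply g phi) psi U.

Definition hadamard_but_last m (psi : state m.+1) : state m.+1 :=
  foldr (@hadamard m.+1) psi [seq i <- enum 'I_m.+1 | i != ord_max].

Definition hc1q_state (G : gateset) m (C : ccircuit G m.+1) : state m.+1 :=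
  hadamard_but_last (apply_fun (crun C) (hadamard_but_last (ket0 m.+1))).

Definition agrees N (p : N.-tuple (option bool)) (x : N.-tuple bool) : bool :=
  [forall i in postselected p, tnth p i == Some (tnth x i)].

Definition remaining N (p : N.-tuple (option bool)) (x : N.-tuple bool) : seq bool :=
  [seq tnth x i | i <- enum (~: postselected p)].

(** (<b|_S (x) I) psi, as a state of the remaining wires in increasing order. *)
Definition postselect N n (p : N.-tuple (option bool)) (psi : state N) : state n :=
  [ffun y : n.-tuple bool =>
     \sum_(x | agrees p x && (remaining p x == y :> seq bool)) psi x].

End States.

(** * Descriptions as bit strings

    Numbers are written in unary; wire indices are below the number of wires,
    which is itself part of the description, so this only changes lengths
    polynomially. *)

Definition enc_nat (k : nat) : seq bool := nseq k true ++ [:: false].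

Definition enc_seq (T : Type) (e : T -> seq bool) (s : seq T) : seq bool :=
  flatten [seq true :: e a | a <- s] ++ [:: false].

Definition enc_optb (o : option bool) : seq bool :=
  if o is Some b then [:: true; b] else [:: false].

(** The string 1^n. *)
Definition unary (n : nat) : seq bool := nseq n true.

Section Encodings.
Variable G : gateset.

Definition csym_code (s : csym G) : nat :=
  match s with X => 0 | CNOT => 1 | Toffoli => 2 | Extra g => 3 + enum_rank g end.

Definition enc_cgate n (g : cgate G n) : seq bool :=
  enc_nat (csym_code (cg_sym g)) ++
  enc_seq (fun i : 'I_n => enc_nat i) (cg_wires g).

Definition enc_qgate n (g : qgate G n) : seq bool :=
  match g with
  | Had i => false :: enc_nat i
  | Classical h => true :: enc_cgate h
  end.

Definition enc_qcircuit (d : {n : nat & qcircuit G n}) : seq bool :=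
  enc_nat (tag d) ++ enc_seq (@enc_qgate (tag d)) (tagged d).

Definition enc_hc1q (h : hc1q_post G) : seq bool :=
  enc_nat (hc_qubits h) ++ enc_seq (@enc_cgate _) (hc_circuit h) ++
  enc_seq enc_optb (hc_post h).

End Encodings.

(* Main.v *)
(** Write H for the Hadamards on all data wires. An HC1Q circuit starts from the
    uniform superposition H|0^n> and ends with H, so it is enough to simulate
    H U H in between. Classical gates are kept. A Hadamard on wire d is simulated
    with a fresh uniform ancilla r: the phase (-1)^(d r) is accumulated by a Toffoli
    gate on a phase wire, two CNOT gates move r into d, and postselecting the
    ancilla on 0 after its final Hadamard sums over the old value of d. The phase
    wire ends with a Hadamard and is postselected on 1, i.e. projected on <-|, which
    turns its bit into a sign; it has to start in |0>, the state of the only qubit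
    without Hadamards, whose bit is swapped in first.

    For polynomial time, a program of the machine model reads the description of U
    and writes the description of the HC1Q circuit; wires are numbered so that
    data wires keep their indices and classical gates are copied verbatim. *)

Require Import Defs.
From Stdlib Require Import FunctionalExtensionality.
From mathcomp Require Import all_boot all_order all_algebra all_fingroup.
From mathcomp Require Import zify ring.

Set Implicit Arguments.
Unset Strict Implicit.
Unset Printing Implicit Defensive.

Import GRing.Theory Num.Theory.

(** * Programs and polynomial time *)

(** Only an upper bound on the running time is recorded, so that costs can be rounded up wherever
    runs are composed. *)
Definition runs (p : prog) (s : store) (T : nat) (s' : store) : Prop :=
  exists2 t, t <= T & exec p s t s'.

Lemma updE s r v q : upd s r v q = if q == r then v else s q.
Proof. by []. Qed.

Lemma upd_upd s r v v' : upd (upd s r v) r v' = upd s r v'.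
Proof. by apply: functional_extensionality => q; rewrite !updE; case: eqP. Qed.

Lemma upd_same s r v : s r = v -> upd s r v = s.
Proof.
by move=> <-; apply: functional_extensionality => q; rewrite updE; case: eqP => // ->.
Qed.

Lemma runs_leq p s T T' s' : runs p s T s' -> T <= T' -> runs p s T' s'.
Proof. by case=> t le_tT ex le_TT'; exists t; rewrite ?(leq_trans le_tT). Qed.

Lemma runs_skip s : runs Skip s 1 s.
Proof. by exists 1; last exact: ExecSkip. Qed.

Lemma runs_push r b s : runs (Push r b) s 1 (upd s r (b :: s r)).
Proof. by exists 1; last exact: ExecPush. Qed.

Lemma runs_pop r s : runs (Pop r) s 1 (upd s r (behead (s r))).
Proof. by exists 1; last exact: ExecPop. Qed.

Lemma runs_seq p q s T s1 T' s2 :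
  runs p s T s1 -> runs q s1 T' s2 -> runs (Seq p q) s (T + T') s2.
Proof.
move=> [t le_t ex] [u le_u ex']; exists (t + u); first exact: leq_add.
exact: ExecSeq ex ex'.
Qed.

Lemma runs_case r pn p0 p1 s T s1 :
  runs (match s r with [::] => pn | false :: _ => p0 | true :: _ => p1 end) s T s1 ->
  runs (Case r pn p0 p1) s T.+1 s1.
Proof. by case=> t le_t ex; exists t.+1 => //; apply: ExecCase. Qed.

Lemma runs_while r p (s : nat -> store) k B :
    (forall j, j < k -> s j r <> [::] /\ runs p (s j) B (s j.+1)) ->
    s k r = [::] ->
  runs (While r p) (s 0) (k * B.+1).+1 (s k).
Proof.
elim: k s => [|k IHk] s step stop; first by exists 1; last exact: ExecWhileStop.
have [ne0 [t le_t ex]] := step 0 isT.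
have [|u le_u ex'] := IHk (fun j => s j.+1) _ stop; first by move=> j; apply: (step j.+1).
exists (t + u).+1; last exact: ExecWhileStep ne0 ex ex'.
by rewrite mulSn; lia.
Qed.

(** Here [s j] is the store with [j] iterations still to go; register [r] is the loop counter in
    unary, so the index runs backwards from [k]. *)
Lemma runs_countdown r p (s : nat -> store) k B :
    (forall j, s j r = nseq j true) ->
    (forall j, j < k -> runs p (s j.+1) B (s j)) ->
  runs (While r p) (s k) (k * B.+1).+1 (s 0).
Proof.
move=> sr step.
have := @runs_while r p (fun j => s (k - j)) k B; rewrite subn0 subnn; apply; last exact: sr.
move=> j ltjk; rewrite sr -subSS subSn //; split=> //.
by apply: step; lia.
Qed.

Definition clear r := While r (Pop r).

Lemma runs_clear r s : runs (clear r) s (size (s r)).*2.+1 (upd s r [::]).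
Proof.
have step j : j < size (s r) -> upd s r (drop j (s r)) r <> [::] /\
    runs (Pop r) (upd s r (drop j (s r))) 1 (upd s r (drop j.+1 (s r))).
  move=> ltj; rewrite updE eqxx; split.
    by move/(congr1 size); rewrite size_drop; move/eqP; rewrite subn_eq0 leqNgt ltj.
  have := runs_pop r (upd s r (drop j (s r))).
  by rewrite updE eqxx upd_upd -drop1 drop_drop add1n.
have := runs_while step; rewrite drop_size updE eqxx drop0 muln2 => /(_ erefl).
by rewrite [upd s r (s r)]upd_same.
Qed.

(** * Polynomially bounded functions *)

(** The base [L.+1] is positive, so its powers are monotone in the exponent and the class is closed
    under sums and products, [L = 0] included. *)
Definition polyb (f : nat -> nat) := exists c k, forall L, f L <= c * L.+1 ^ k.

Lemma polyb_leq f g : polyb g -> (forall L, f L <= g L) -> polyb f.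
Proof. by move=> [c [k le_g]] le_fg; exists c, k => L; apply: leq_trans (le_g L). Qed.

Lemma polyb_const a : polyb (fun=> a).
Proof. by exists a, 0 => L; rewrite muln1. Qed.

Lemma polyb_id : polyb id.
Proof. by exists 1, 1 => L; rewrite mul1n. Qed.

Lemma polyb_add f g : polyb f -> polyb g -> polyb (fun L => f L + g L).
Proof.
move=> [c [k lef]] [d [l leg]]; exists (c + d), (k + l) => L; rewrite mulnDl.
apply: leq_add; [apply: leq_trans (lef L) _ | apply: leq_trans (leg L) _];
  by rewrite leq_mul2l leq_pexp2l ?orbT // ?leq_addr ?leq_addl.
Qed.

Lemma polyb_mul f g : polyb f -> polyb g -> polyb (fun L => f L * g L).
Proof.
move=> [c [k lef]] [d [l leg]]; exists (c * d), (k + l) => L.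
by rewrite expnD mulnACA; apply: leq_mul.
Qed.

Lemma polyb_exp f k : polyb f -> polyb (fun L => f L ^ k).
Proof.
move=> pf; elim: k => [|k IHk]; first exact: polyb_const.
by apply: polyb_leq (polyb_mul pf IHk) _ => L; rewrite expnS.
Qed.

Lemma polybP f : polyb f <-> exists c k, forall L, f L <= c * L ^ k + c.
Proof.
split=> [[c [k lef]]|[c [k lef]]]; last first.
  apply: (fun p => polyb_leq p lef); apply: polyb_add (polyb_const c).
  exact: polyb_mul (polyb_const c) (polyb_exp k polyb_id).
(* For positive [L], [L.+1 <= 2 * L] costs the factor [2 ^ k]; at [L = 0] the additive constant
   suffices. *)
exists (c * 2 ^ k), k => L; apply: leq_trans (lef L) _.
rewrite -mulnSr -mulnA leq_mul2l; apply/orP; right.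
case: L {lef} => [|L]; first by rewrite exp1n muln_gt0 expn_gt0.
rewrite mulnSr -expnMn; apply: leq_trans (leq_addr _ _).
by case: k => [|k] //; rewrite leq_exp2r; lia.
Qed.

(** * Resource bounds for executions and composition of polynomial-time maps *)

Fixpoint maxreg (p : prog) : nat :=
  match p with
  | Skip => 0
  | Push r _ | Pop r => r
  | Seq p q => maxn (maxreg p) (maxreg q)
  | Case r p q p' => maxn r (maxn (maxreg p) (maxn (maxreg q) (maxreg p')))
  | While r p => maxn r (maxreg p)
  end.

Lemma exec_frame p s t s' r : exec p s t s' -> maxreg p < r -> s' r = s r.
Proof.
move=> ex; elim: ex => {p s t s'} //=.
- by move=> q b s ltq; rewrite updE gtn_eqF.
- by move=> q s ltq; rewrite updE gtn_eqF.
- by move=> p q s t s1 u s2 _ IHp _ IHq; rewrite gtn_max => /andP[/IHp<- /IHq].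
- move=> q pn p0 p1 s t s1 _ IH; rewrite !gtn_max => /and4P[_ h1 h2 h3].
  by apply: IH; case: (s q) => [|[] ?].
- move=> q p s t s1 u s2 _ _ IHp _ IHq ltr; rewrite IHq // IHp //.
  by move: ltr; rewrite gtn_max => /andP[].
Qed.

Lemma exec_size p s t s' r : exec p s t s' -> size (s' r) <= size (s r) + t.
Proof.
move=> ex; elim: ex => {p s t s'} //=.
- by move=> s; rewrite leq_addr.
- by move=> q b s; rewrite updE; case: eqP => [->|] /=; rewrite ?addn1 ?leqnSn.
- by move=> q s; rewrite updE; case: eqP => [->|]; rewrite ?size_behead; lia.
- by move=> p q s t s1 u s2 _ IHp _ IHq; lia.
- by move=> q pn p0 p1 s t s1 _ IH; lia.
- by move=> q p s _; lia.
- by move=> q p s t s1 u s2 _ _ IHp _ IHq; lia.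
Qed.

(** A program may leave rubbish in its scratch registers, whereas the next one expects an [init]
    store; register 0, which carries the result, is spared. *)
Fixpoint clear_upto m := if m is m'.+1 then Seq (clear m) (clear_upto m') else Skip.

Lemma runs_clear_upto m B s :
    (forall r, 0 < r -> size (s r) <= B) -> (forall r, m < r -> s r = [::]) ->
  runs (clear_upto m) s (m * B.*2.+1).+1 (init (s 0)).
Proof.
elim: m s => [|m IHm] s leB nil.
  suff ->: init (s 0) = s by exact: runs_skip.
  apply: functional_extensionality => -[|r] //; rewrite /init updE /=.
  by rewrite nil.
have le0 r : 0 < r -> size (upd s m.+1 [::] r) <= B.
  by move=> /leB; rewrite updE; case: eqP.
have nil0 r : m < r -> upd s m.+1 [::] r = [::].
  by move=> ltmr; rewrite updE; case: eqP => // /eqP ne; rewrite nil // ltn_neqAle eq_sym ne.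
apply: runs_leq (runs_seq (runs_clear m.+1 s) (IHm _ le0 nil0)) _.
by rewrite mulSn; have := leB m.+1 isT; lia.
Qed.

Lemma polytimeP (A B : Type) (encA : A -> seq bool) (encB : B -> seq bool) f :
  polytime encA encB f <->
  exists p (T : nat -> nat), polyb T /\ forall a, exists2 s,
    runs p (init (encA a)) (T (size (encA a))) s & s 0 = encB (f a).
Proof.
split=> [[p [c [k pP]]]|[p [T [/polybP[c [k leT]] pP]]]].
  exists p, (fun L => c * L ^ k + c); split; first by apply/polybP; exists c, k.
  by move=> a; have [t [s [ex le_t eqs]]] := pP a; exists s => //; exists t.
exists p, c, k => a; have [s [t le_t ex] eqs] := pP a; exists t, s; split=> //.
exact: leq_trans le_t (leT _).
Qed.

(** The first program runs, its scratch registers are emptied, then the second runs. A step adds at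
    most one bit to a register, so both the rubbish and the intermediate result are no longer than
    the input length plus the running time. *)
Lemma polytime_comp (A B C : Type) (encA : A -> seq bool) (encB : B -> seq bool)
    (encC : C -> seq bool) f g :
  polytime encA encB f -> polytime encB encC g -> polytime encA encC (fun a => g (f a)).
Proof.
move=> /polytimeP[p [T [pT pP]]] [q [c [k qP]]].
apply/polytimeP; exists (Seq p (Seq (clear_upto (maxreg p)) q)).
exists (fun L => T L + ((maxreg p * (T L).*2.+1).+1 + (c * (L + T L) ^ k + c))); split.
  apply: (polyb_add pT); apply: polyb_add; last apply: polyb_add.
    apply: polyb_leq (polyb_add (polyb_const (maxreg p).+1)
      (polyb_mul (polyb_const (maxreg p).*2) pT)) _ => L.
    by rewrite -!muln2; nia.
    exact: polyb_mul (polyb_const c) (polyb_exp k (polyb_add polyb_id pT)).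
  exact: polyb_const.
move=> a; have [s run_p s0] := pP a; have [u [s' [ex_q le_u s'0]]] := qP (f a).
exists s' => //; apply: (runs_seq run_p); case: run_p => t le_t ex_p.
apply: (@runs_seq _ _ _ _ (init (encB (f a)))).
  rewrite -s0; apply: runs_clear_upto => [r r_gt0|r lt_r].
    by have := exec_size r ex_p; rewrite /init updE gtn_eqF //=; lia.
  by rewrite (exec_frame ex_p lt_r) /init updE gtn_eqF //; lia.
exists u => //; apply: leq_trans le_u _; rewrite leq_add2r leq_mul2l; apply/orP; right.
have := exec_size 0 ex_p; rewrite s0 /init updE eqxx => le_sz.
by case: (k) => // k'; rewrite leq_exp2r //; lia.
Qed.

Lemma polytime_size (A B : Type) (encA : A -> seq bool) (encB : B -> seq bool) f :
  polytime encA encB f ->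
  exists c k, forall a, size (encB (f a)) <= c * size (encA a) ^ k + c.
Proof.
move=> /polytimeP[p [T [pT pP]]].
have /polybP[c [k lec]] := polyb_add polyb_id pT; exists c, k => a.
apply: leq_trans (lec _); have [s [t le_t ex] <-] := pP a.
by have := exec_size 0 ex; rewrite /init updE eqxx; lia.
Qed.

(** * The postselected circuit *)

Section Gates.
Variables (G : gateset) (N : nat).

Definition xgate (a : 'I_N) : cgate G N := @CGate G N X [tuple a] isT.

(** [CGate] demands distinct wires; for [a = b] the value is the dummy [xgate a], so that no proof
    of distinctness has to be passed along. *)
Definition cnot (a b : 'I_N) : cgate G N :=
  if (insub [tuple a; b] : {? w : 2.-tuple 'I_N | uniq w}) is Some u then
    @CGate G N CNOT (sval u) (svalP u) else xgate a.

Definition toffoli (a b c : 'I_N) : cgate G N :=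
  if (insub [tuple a; b; c] : {? w : 3.-tuple 'I_N | uniq w}) is Some u then
    @CGate G N Toffoli (sval u) (svalP u) else xgate a.

Lemma tnth_setbit (x : N.-tuple bool) i b j :
  tnth (setbit x i b) j = if j == i then b else tnth x j.
Proof. by rewrite tnth_mktuple. Qed.

Lemma setbit_same (x : N.-tuple bool) i b c : setbit (setbit x i b) i c = setbit x i c.
Proof. by apply: eq_from_tnth => j; rewrite !tnth_setbit; case: eqP. Qed.

Lemma setbit_id (x : N.-tuple bool) i b : tnth x i = b -> setbit x i b = x.
Proof. by move=> <-; apply: eq_from_tnth => j; rewrite tnth_setbit; case: eqP => // ->. Qed.

Lemma cnot_act (a b : 'I_N) x : a != b ->
  cgate_act (cnot a b) x = setbit x b (tnth x b (+) tnth x a).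
Proof.
move=> neq; apply: eq_from_tnth => j; rewrite tnth_setbit tnth_mktuple /cnot.
case: insubP => [[w u] /= _ /= -> |]; last by rewrite /= inE neq.
rewrite /= !inE; case: (j =P a) => [->|/eqP nja].
  by rewrite (negPf neq) eqxx.
by rewrite [a == j]eq_sym (negPf nja); case: (j =P b) => [->|//]; rewrite eqxx.
Qed.

Lemma toffoli_act (a b c : 'I_N) x : uniq [:: a; b; c] ->
  cgate_act (toffoli a b c) x = setbit x c (tnth x c (+) (tnth x a && tnth x b)).
Proof.
move=> un; apply: eq_from_tnth => j; rewrite tnth_setbit tnth_mktuple /toffoli.
case: insubP => [[w u] /= _ /= -> |]; last by rewrite un.
move: un; rewrite /= !inE negb_or => /and3P[/andP[nab nac] nbc _].
case: (j =P a) => [->|/eqP nja].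
  by rewrite (negPf nac) eqxx.
case: (j =P b) => [->|/eqP njb].
  by rewrite (negPf nbc) (negPf nab) eqxx.
rewrite ![_ == j]eq_sym (negPf nja) (negPf njb).
by case: (j =P c) => [->|].
Qed.

End Gates.

(** * Hadamard transforms and images of states under classical maps *)

Section States.
Variable K : numClosedFieldType.
Local Open Scope ring_scope.

Lemma hadamardK n (i : 'I_n) : involutive (@hadamard K n i).
Proof.
move=> psi; apply/ffunP => x; rewrite !ffunE !tnth_setbit eqxx !setbit_same.
have sq : (sqrtC 2)^-1 * (sqrtC 2)^-1 * 2 = 1 :> K.
  by rewrite -invfM -expr2 sqrtCK mulVf ?pnatr_eq0.
have key (s p q : K) : s * s * 2 = 1 ->
    (s * (s * (p + 1 * q) + 1 * (s * (p + -1 * q))) = p) /\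
    (s * (s * (p + 1 * q) + -1 * (s * (p + -1 * q))) = q).
  move=> ss; split; first by transitivity (s * s * 2 * p); [ring | rewrite ss mul1r].
  by transitivity (s * s * 2 * q); [ring | rewrite ss mul1r].
(* Setting bit [i] of [x] to its own value brings both cases of that bit into the forms treated by
   [key]. *)
have -> : psi x = psi (setbit x i (tnth x i)) by rewrite setbit_id.
by case: (tnth x i); rewrite expr0 expr1; [apply: (key _ _ _ sq).2 | apply: (key _ _ _ sq).1].
Qed.

(** Change of variables for a pushforward: it turns a weighted sum over the state after a classical
    gate into one over the state before it. *)
Lemma sum_apply_fun n (f : n.-tuple bool -> n.-tuple bool) (psi : state K n)
    (P : pred (n.-tuple bool)) (s : n.-tuple bool -> K) :
  \sum_(x | P x) s x * apply_fun f psi x = \sum_(v | P (f v)) s (f v) * psi v.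
Proof.
under eq_bigr => x _ do rewrite ffunE mulr_sumr.
rewrite (exchange_big_dep (fun v => P (f v))) => [|x v Px /eqP->] //=.
apply: eq_bigr => v Pfv; rewrite (big_pred1 (f v)) // => x.
by rewrite /= [x == _]eq_sym; case: eqP => [<-|_]; rewrite ?Pfv ?andbF.
Qed.

Lemma apply_fun_comp n (f g : n.-tuple bool -> n.-tuple bool) (psi : state K n) :
  apply_fun g (apply_fun f psi) = apply_fun (fun x => g (f x)) psi.
Proof.
apply/ffunP => x; rewrite !ffunE.
have := sum_apply_fun f psi (fun w => g w == x) (fun=> 1).
by under eq_bigr do rewrite mul1r; under [RHS]eq_bigr do rewrite mul1r.
Qed.

Lemma eq_apply_fun n (f g : n.-tuple bool -> n.-tuple bool) (psi : state K n) :
  f =1 g -> apply_fun f psi = apply_fun g psi.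
Proof. by move=> fg; apply/ffunP => x; rewrite !ffunE; apply: eq_bigl => w; rewrite fg. Qed.

Definition agree_off n (l : seq 'I_n) (x v : n.-tuple bool) :=
  [forall j, (j \notin l) ==> (tnth v j == tnth x j)].

Lemma agree_offP n (l : seq 'I_n) (x v : n.-tuple bool) :
  reflect (forall j, j \notin l -> tnth v j = tnth x j) (agree_off l x v).
Proof. by apply: (iffP 'forall_implyP) => H j /H; [move/eqP | move->]. Qed.

Definition dotl n (l : seq 'I_n) (x v : n.-tuple bool) : nat :=
  \sum_(j <- l) (tnth x j && tnth v j).

(** Hadamards on the wires of [l] form the Fourier transform over Z/2 in those coordinates, with
    characters [(-1) ^+ dotl l x v]. The induction peels off one wire and splits the sum by the bit
    of [v] there. *)
Lemma foldr_hadamardE n (l : seq 'I_n) (psi : state K n) x : uniq l ->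
  foldr (@hadamard K n) psi l x =
  (sqrtC 2)^-1 ^+ size l * \sum_(v | agree_off l x v) (-1) ^+ dotl l x v * psi v.
Proof.
elim: l x => [|i l IHl] x /=.
  move=> _; rewrite mul1r (big_pred1 x) => [|v].
    by rewrite /dotl big_nil mul1r.
  apply/agree_offP/eqP => [H|-> //]; apply: eq_from_tnth => j; exact: H.
move=> /andP[il ul]; rewrite ffunE !IHl // exprS -!mulrA; congr (_ * _).
rewrite mulrCA -mulrDr; congr (_ * _).
rewrite [RHS](partition_big (fun v => tnth v i) xpredT) //= big_bool /= [RHS]addrC.
have ag b v : agree_off (i :: l) x v && (tnth v i == b) = agree_off l (setbit x i b) v.
  apply/andP/agree_offP => [[/agree_offP H /eqP vb] j jl|H].
    by rewrite tnth_setbit; case: eqP => [->//|/eqP ne]; apply: H; rewrite inE negb_or ne.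
  split; last by rewrite H // tnth_setbit eqxx.
  apply/agree_offP => j; rewrite inE negb_or => /andP[/negPf ne jl].
  by rewrite H // tnth_setbit ne.
have dt b v : dotl l (setbit x i b) v = dotl l x v.
  apply: eq_big_seq => j jl; rewrite tnth_setbit; case: eqP => // eji.
  by rewrite -eji jl in il.
rewrite mulr_sumr; congr (_ + _); apply: eq_big => v; rewrite ?(esym (ag _ _)) //.
  by move=> /andP[_ /eqP vb]; rewrite dt /dotl big_cons vb andbF.
by move=> /andP[_ /eqP vb]; rewrite dt /dotl big_cons vb andbT exprD mulrA.
Qed.

End States.

(** * Wire layout and translation of gates *)

Section Translation.
Variables (G : gateset) (n h : nat).

Lemma data_wire_proof : n <= (n.+1 + h).+1.
Proof. lia. Qed.

(** Data wires come first, then the phase wire [n], the ancillas [n.+1] to [n + h], and finally the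
    wire without Hadamards. *)
Definition dwire (i : 'I_n) : 'I_(n.+1 + h).+1 := widen_ord data_wire_proof i.
Definition pwire : 'I_(n.+1 + h).+1 := inord n.
Definition awire (k : nat) : 'I_(n.+1 + h).+1 := inord (n.+1 + k).

Lemma dwire_inj : injective dwire.
Proof. by move=> i j /(congr1 val) /= /val_inj. Qed.

Lemma val_pwire : pwire = n :> nat.
Proof. by rewrite inordK //; lia. Qed.

Lemma val_awire k : k <= h -> awire k = n.+1 + k :> nat.
Proof. by move=> le_kh; rewrite inordK //; lia. Qed.

Lemma lift_gate_proof (g : cgate G n) : uniq [tuple of map dwire (cg_wires g)].
Proof. by rewrite map_inj_uniq ?cg_uniq //; apply: dwire_inj. Qed.

Definition lift_gate (g : cgate G n) : cgate G (n.+1 + h).+1 :=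
  CGate (lift_gate_proof g).

Definition gadget (k : nat) (i : 'I_n) : ccircuit G (n.+1 + h).+1 :=
  [:: toffoli G (dwire i) (awire k) pwire; cnot G (dwire i) (awire k);
      cnot G (awire k) (dwire i)].

Fixpoint translate (k : nat) (U : qcircuit G n) : ccircuit G (n.+1 + h).+1 :=
  match U with
  | [::] => [::]
  | Had i :: U' => gadget k i ++ translate k.+1 U'
  | Classical g :: U' => lift_gate g :: translate k U'
  end.

(** Two CNOT gates exchange the phase wire with the last wire as long as the latter is in |0>, as it
    is at the start. Afterwards the last wire carries the uniform bit. *)
Definition clean_phase : ccircuit G (n.+1 + h).+1 :=
  [:: cnot G pwire ord_max; cnot G ord_max pwire].

Definition data (v : (n.+1 + h).+1.-tuple bool) : n.-tuple bool :=
  [tuple tnth v (dwire i) | i < n].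

Lemma tnth_data v i : tnth (data v) i = tnth v (dwire i).
Proof. by rewrite tnth_mktuple. Qed.

Definition fresh k (z v : (n.+1 + h).+1.-tuple bool) :=
  [forall j : 'I_(n.+1 + h).+1, (n.+1 + k <= j) ==> (tnth v j == tnth z j)].

Lemma freshP k z v :
  reflect (forall j : 'I_(n.+1 + h).+1, n.+1 + k <= j -> tnth v j = tnth z j)
          (fresh k z v).
Proof. by apply: (iffP 'forall_implyP) => H j /H; [move/eqP | move->]. Qed.

Lemma pwireNdwire i : pwire != dwire i.
Proof. by rewrite -val_eqE /= val_pwire; have := ltn_ord i; lia. Qed.

Lemma awireNdwire k i : k <= h -> awire k != dwire i.
Proof. by move=> le_kh; rewrite -val_eqE /= val_awire //; have := ltn_ord i; lia. Qed.

Lemma awireNpwire k : k <= h -> awire k != pwire.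
Proof. by move=> le_kh; rewrite -val_eqE /= val_pwire val_awire //; lia. Qed.

Lemma fresh_wire k i (j : 'I_(n.+1 + h).+1) : n.+1 + k <= j ->
  ((j == dwire i) = false) * ((j == pwire) = false).
Proof. by move=> le_j; rewrite -!val_eqE /= val_pwire; have := ltn_ord i; split; lia. Qed.

Lemma fresh_wireS k (j : 'I_(n.+1 + h).+1) : k <= h ->
  (n.+1 + k.+1 <= j) = (j != awire k) && (n.+1 + k <= j).
Proof. by move=> le_kh; rewrite -val_eqE /= val_awire // addnS ltn_neqAle eq_sym. Qed.

(** The Toffoli gate comes first and sees the old bits. The first CNOT leaves the XOR of both bits
    on the ancilla; in the second one the old data bit cancels, so the data wire receives the old
    ancilla bit. *)
Lemma crun_gadget k i v : k <= h ->
  crun (gadget k i) v =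
  setbit (setbit (setbit v pwire (tnth v pwire (+) (tnth v (dwire i) && tnth v (awire k))))
    (awire k) (tnth v (awire k) (+) tnth v (dwire i))) (dwire i) (tnth v (awire k)).
Proof.
move=> le_kh; have /negPf Npd := pwireNdwire i; have /negPf Nap := awireNpwire le_kh.
have /negPf Nad := awireNdwire i le_kh.
have Ndp : (dwire i == pwire) = false by rewrite eq_sym.
have Nda : (dwire i == awire k) = false by rewrite eq_sym.
have Npa : (pwire == awire k) = false by rewrite eq_sym.
rewrite /= toffoli_act /= ?inE ?negb_or ?Nda ?Ndp ?Nap // cnot_act ?Nad // cnot_act ?Nda //.
by rewrite !tnth_setbit !(eqxx, Npd, Nap, Nad, Ndp, Nda, Npa) addbCA addbb addbF.
Qed.

Lemma data_lift (g : cgate G n) v : data (cgate_act (lift_gate g) v) = cgate_act g (data v).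
Proof.
apply: eq_from_tnth => i; rewrite !tnth_mktuple /=.
rewrite (mem_map dwire_inj) (index_map dwire_inj).
congr (if _ then nth false (csym_act _) _ else _).
by apply: val_inj; rewrite /= -map_comp; apply: eq_map => j; rewrite /= tnth_mktuple.
Qed.

Lemma lift_out (g : cgate G n) v (j : 'I_(n.+1 + h).+1) : n <= j ->
  tnth (cgate_act (lift_gate g) v) j = tnth v j.
Proof.
move=> le_nj; rewrite tnth_mktuple /= ifF //.
by apply/mapP => -[i _ eq_j]; have := ltn_ord i; rewrite eq_j /= in le_nj; lia.
Qed.

(** * The simulation invariant and its preservation by gates *)

Section Readout.
Variable K : numClosedFieldType.
Local Open Scope ring_scope.
Local Notation N := (n.+1 + h).+1.

(** The amplitude at [y] of the data wires when the used ancillas are projected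
    on [<+|] and the phase wire on [<-|], the fresh wires having the values in [z]. *)
Definition readout (Psi : state K N) k (y : n.-tuple bool) (z : N.-tuple bool) : K :=
  \sum_(v | (data v == y) && fresh k z v) (-1) ^+ tnth v pwire * Psi v.

(** One scalar serves all values [z]: after the projections, the fresh wires are still uniform and
    uncorrelated with the data. The scalar also absorbs normalization. *)
Definition represents k (Psi : state K N) (psi : state K n) :=
  exists2 c : K, c != 0 & forall y z, readout Psi k y z = c * psi y.

(** A lifted gate touches neither the phase wire nor the fresh wires, so grouping basis vectors by
    their data part reduces the claim to the image under the gate on [n] bits. *)
Lemma represents_lift k (g : cgate G n) Psi psi :
  represents k Psi psi ->
  represents k (apply_fun (cgate_act (lift_gate g)) Psi) (apply_fun (cgate_act g) psi).
Proof.
move=> [c c0 rep]; exists c => // y z.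
rewrite /readout sum_apply_fun ffunE mulr_sumr.
rewrite (partition_big data (fun y' => cgate_act g y' == y)) => [|v]; last first.
  by rewrite data_lift => /andP[].
apply: eq_bigr => y' /eqP gy'; rewrite -(rep y' z); apply: eq_big => v.
  rewrite data_lift andbC; case: eqP => //= ->; rewrite gy' eqxx /=.
  by apply/freshP/freshP => H j le_j; rewrite -H // lift_out //; lia.
by rewrite lift_out // val_pwire.
Qed.

(** The new data bit is the old ancilla bit, so only vectors whose ancilla equals bit [i] of [y]
    contribute. The two old values of the data bit give the two terms of the Hadamard, with the sign
    supplied by the phase wire. *)
Lemma represents_gadget k i Psi psi : (k < h)%N ->
  represents k Psi psi ->
  represents k.+1 (apply_fun (crun (gadget k i)) Psi) (hadamard i psi).
Proof.
move=> lt_kh [c c0 rep]; have le_kh := ltnW lt_kh.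
have s0 : sqrtC 2 != 0 :> K by rewrite sqrtC_eq0 pnatr_eq0.
have /negPf Npd := pwireNdwire i; have /negPf Nap := awireNpwire le_kh.
have Nad j : (awire k == dwire j) = false by rewrite (negPf (awireNdwire j le_kh)).
(* The gadget adds the two terms without the factor [(sqrtC 2)^-1]. *)
exists (c * sqrtC 2) => [|y z]; first by rewrite mulf_neq0.
rewrite /readout sum_apply_fun ffunE mulrA mulfK //.
have dataE v : data (crun (gadget k i) v) = setbit (data v) i (tnth v (awire k)).
  apply: eq_from_tnth => j; rewrite crun_gadget // tnth_setbit !tnth_data !tnth_setbit.
  rewrite (inj_eq dwire_inj) [dwire j == awire k]eq_sym Nad.
  by rewrite [dwire j == pwire]eq_sym (negPf (pwireNdwire j)).
rewrite (partition_big (fun v => tnth v (dwire i)) xpredT) //= big_bool /= addrC mulrDr.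
have step b : \sum_(v | (data (crun (gadget k i) v) == y) && fresh k.+1 z (crun (gadget k i) v)
      && (tnth v (dwire i) == b)) (-1) ^+ tnth (crun (gadget k i) v) pwire * Psi v =
    (-1) ^+ (b && tnth y i) * (c * psi (setbit y i b)).
  (* Before the gadget the ancilla was fresh, so prescribing its value only changes [z];
     independence of [z] in the invariant makes this harmless. *)
  rewrite -(rep _ (setbit z (awire k) (tnth y i))) mulr_sumr; apply: eq_big => v.
    rewrite dataE; apply/idP/idP.
      move=> /andP[/andP[/eqP <- /freshP fr] /eqP <-]; apply/andP; split.
        by rewrite setbit_same setbit_id ?tnth_data.
      apply/freshP => j le_j; rewrite !tnth_setbit eqxx; case: eqP => [-> //|/eqP ja].
      rewrite -fr; last by rewrite fresh_wireS // ja.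
      by rewrite crun_gadget // !tnth_setbit (negPf ja) !(fresh_wire i le_j).
    move=> /andP[/eqP dv /freshP fr].
    have va : tnth v (awire k) = tnth y i.
      by rewrite fr ?val_awire // tnth_setbit eqxx.
    have vd : tnth v (dwire i) = b.
      by have := congr1 (fun t => tnth t i) dv; rewrite tnth_data tnth_setbit eqxx.
    rewrite dv va vd setbit_same setbit_id // !eqxx andbT; apply/freshP => j le_j.
    move: le_j; rewrite fresh_wireS // => /andP[/negPf na le_j].
    by rewrite crun_gadget // !tnth_setbit na !(fresh_wire i le_j) fr // tnth_setbit na.
  move=> /andP[/andP[/eqP dv _] /eqP vd].
  have va : tnth v (awire k) = tnth y i by rewrite -dv dataE tnth_setbit eqxx.
  rewrite crun_gadget // !tnth_setbit Npd [pwire == _]eq_sym Nap eqxx.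
  by rewrite signr_addb vd va; ring.
rewrite (step true) (step false) /=; ring.
Qed.

Definition is_had (g : qgate G n) := if g is Had _ then true else false.

Lemma represents_translate k (U : qcircuit G n) Psi psi :
  (k + count is_had U <= h)%N -> represents k Psi psi ->
  represents (k + count is_had U) (apply_fun (crun (translate k U)) Psi) (qrun U psi).
Proof.
elim: U k Psi psi => [|[i|g] U IHU] k Psi psi /=.
- by rewrite addn0 => _ [c c0 rep]; exists c => // y z; rewrite -(rep y z); congr (readout _ _ _ _);
  apply/ffunP => x; rewrite ffunE (big_pred1 x).
- rewrite addnA addn1 => le_h rep.
  have := IHU k.+1 _ _ le_h (represents_gadget i (leq_trans (leq_addr _ _) le_h) rep).
  by rewrite apply_fun_comp.
- rewrite add0n => le_h /(represents_lift g) /(IHU k _ _ le_h).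
  by rewrite apply_fun_comp.
Qed.

(** * The initial state satisfies the invariant *)

Lemma foldr_hadamard_ket0 m (l : seq 'I_m) x : uniq l ->
  foldr (@hadamard K m) (ket0 K m) l x =
  (sqrtC 2)^-1 ^+ size l * (agree_off l x [tuple of nseq m false])%:R.
Proof.
move=> ul; rewrite foldr_hadamardE //; congr (_ * _).
rewrite big_mkcond (bigD1 [tuple of nseq m false]) //= ffunE eqxx big1 => [|v /negPf nv].
  rewrite addr0 mulr1; case: ifP => // _; rewrite /dotl big1 // => j _.
  by rewrite tnth_nseq andbF.
by case: ifP => // _; rewrite ffunE nv mulr0.
Qed.

Definition put (y : n.-tuple bool) (z : N.-tuple bool) : N.-tuple bool :=
  [tuple if insub (val j) is Some i then tnth y i else tnth z j | j < N].

Lemma put_dwire y z i : tnth (put y z) (dwire i) = tnth y i.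
Proof.
rewrite tnth_mktuple; case: insubP => [j _ /val_inj -> //|].
by rewrite /= ltn_ord.
Qed.

Lemma put_out y z (j : 'I_N) : (n <= j)%N -> tnth (put y z) j = tnth z j.
Proof. by move=> le_nj; rewrite tnth_mktuple insubF // ltnNge le_nj. Qed.

Lemma data_put y z : data (put y z) = y.
Proof. by apply: eq_from_tnth => i; rewrite tnth_data put_dwire. Qed.

Lemma eq_put v y z : data v = y -> (forall j : 'I_N, n <= j -> tnth v j = tnth z j)%N ->
  v = put y z.
Proof.
move=> <- eqz; apply: eq_from_tnth => j; have [lt_jn|le_nj] := ltnP j n; last first.
  by rewrite put_out // eqz.
have -> : j = dwire (Ordinal lt_jn) by apply: val_inj.
by rewrite put_dwire tnth_data.
Qed.

Lemma ltn_pwire_max : (pwire < @ord_max (n.+1 + h))%N.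
Proof. by rewrite val_pwire /=; lia. Qed.

Lemma crun_clean v : crun clean_phase v =
  setbit (setbit v ord_max (tnth v ord_max (+) tnth v pwire)) pwire (tnth v ord_max).
Proof.
have ne : pwire != ord_max by rewrite -val_eqE ltn_eqF ?ltn_pwire_max.
have ne' : @ord_max (n.+1 + h) != pwire by rewrite eq_sym.
rewrite /= cnot_act // cnot_act // !tnth_setbit eqxx (negPf ne).
by rewrite addbCA addbb addbF.
Qed.

(** For given [y] and [z] a single basis vector contributes. Its phase bit is 0 after cleaning and
    its amplitude does not depend on [y] or [z], so the data wires are in the uniform
    superposition. *)
Lemma represents_init :
  represents 0 (apply_fun (crun clean_phase) (hadamard_but_last (ket0 K N)))
    (foldr (@hadamard K n) (ket0 K n) (enum 'I_n)).
Proof.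
have s0 k : (sqrtC 2)^-1 ^+ k != 0 :> K.
  by rewrite expf_neq0 // invr_eq0 sqrtC_eq0 pnatr_eq0.
set l := [seq i <- enum 'I_N | i != ord_max].
have ul : uniq l by rewrite filter_uniq ?enum_uniq.
exists ((sqrtC 2)^-1 ^+ size l / (sqrtC 2)^-1 ^+ size (enum 'I_n)) => [|y z].
  by rewrite mulf_neq0 ?invr_eq0.
have -> : foldr (@hadamard K n) (ket0 K n) (enum 'I_n) y = (sqrtC 2)^-1 ^+ size (enum 'I_n).
  rewrite foldr_hadamard_ket0 ?enum_uniq // [agree_off _ _ _](_ : _ = true) ?mulr1 //.
  by apply/agree_offP => j; rewrite mem_enum.
rewrite mulfVK // /readout sum_apply_fun.
have ne : (ord_max == pwire :> 'I_N) = false by rewrite -val_eqE gtn_eqF ?ltn_pwire_max.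
have Edw i : (dwire i == pwire) = false by rewrite eq_sym (negPf (pwireNdwire i)).
have Edm i : (dwire i == ord_max) = false.
  by rewrite -val_eqE /= ltn_eqF //; have := ltn_ord i; lia.
have dataE v : data (crun clean_phase v) = data v.
  by apply: eq_from_tnth => i; rewrite crun_clean !tnth_data !tnth_setbit Edw Edm.
(* The preimage under [clean_phase]: the old phase bit ends on the last wire, so it must be the
   value of [z] there, while the last wire itself still holds 0. *)
pose v0 := put y (setbit (setbit z pwire (tnth z ord_max)) ord_max false).
have v0m : tnth v0 ord_max = false by rewrite put_out ?tnth_setbit ?eqxx //=; lia.
have v0p : tnth v0 pwire = tnth z ord_max.
  by rewrite put_out ?val_pwire // !tnth_setbit eq_sym ne eqxx.
have freshE v : tnth v ord_max = false -> data v = y ->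
    fresh 0 z (crun clean_phase v) = (v == v0).
  move=> vm dv; rewrite crun_clean vm addFb; apply/freshP/eqP => [H|-> j le_j].
    apply: eq_put => // j le_nj; rewrite !tnth_setbit; case: (j =P ord_max) => [-> //|/eqP jm].
    case: (j =P pwire) => [->|/eqP jp].
      by rewrite -H ?tnth_setbit ?ne ?eqxx //=; lia.
    rewrite -H ?tnth_setbit ?(negPf jm) ?(negPf jp) //.
    by move: jp; rewrite -val_eqE /= val_pwire; lia.
  have jp : (j == pwire) = false by rewrite -val_eqE /= val_pwire; lia.
  rewrite !tnth_setbit jp; case: eqP => [-> //|/eqP jm].
  by rewrite put_out ?tnth_setbit ?jp ?(negPf jm) //; lia.
have ketE v : hadamard_but_last (ket0 K N) v = (sqrtC 2)^-1 ^+ size l * (~~ tnth v ord_max)%:R.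
  rewrite /hadamard_but_last foldr_hadamard_ket0 //; congr (_ * (nat_of_bool _)%:R).
  have lE j : (j \notin l) = (j == ord_max) by rewrite mem_filter mem_enum andbT negbK.
  apply/agree_offP/idP => [/(_ ord_max)|/negPf vm j].
    by rewrite lE eqxx tnth_nseq => /(_ isT) <-.
  by rewrite lE => /eqP ->; rewrite tnth_nseq vm.
rewrite big_mkcond (bigD1 v0) // big1 => [|v /negPf nv].
  rewrite Monoid.mulm1 dataE freshE ?data_put // !eqxx ketE v0m mulr1 crun_clean tnth_setbit eqxx v0m.
  by rewrite mul1r.
case: ifP => //; rewrite dataE ketE => /andP[/eqP dv]; case vm : (tnth v ord_max).
  by rewrite !mulr0.
by rewrite freshE // nv.
Qed.

(** * Final Hadamards and postselection *)

(** Taken together with the final Hadamards, outcome 1 projects the phase wire on <-| and outcome 0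
    projects an ancilla on <+|; the last wire has no Hadamard, and its bit is fixed to 0. *)
Definition outcome : N.-tuple (option bool) :=
  [tuple if (j < n)%N then None else Some (j == n :> nat) | j < N].

Lemma postselected_outcome : postselected outcome = [set j : 'I_N | n <= j]%N.
Proof. by apply/setP => j; rewrite !inE tnth_mktuple ltnNge; case: leqP. Qed.

Lemma card_postselected : (#|postselected outcome| + n)%N = N.
Proof.
rewrite postselected_outcome -[RHS]card_ord -(cardsC [set j : 'I_N | n <= j]%N).
congr addn; transitivity #|[set dwire i | i : 'I_n]|.
  by rewrite (card_imset _ dwire_inj) card_ord.
apply: eq_card => j; rewrite !inE -ltnNge.
apply/imsetP/idP => [[i _ ->] /=|lt_jn]; first exact: ltn_ord.
by exists (Ordinal lt_jn) => //; apply: val_inj.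
Qed.

(** The data wires have the smallest indices, so listing the remaining wires in increasing order
    gives them in their own order. Passing to underlying numbers turns this into filtering an
    [iota]. *)
Lemma remaining_outcome v : remaining outcome v = data v.
Proof.
rewrite /remaining postselected_outcome.
have -> : [seq tnth v i | i <- enum (~: [set j : 'I_N | n <= j]%N)] =
    [seq nth false v j | j <- map val (enum (~: [set j : 'I_N | n <= j]%N))].
  by rewrite -map_comp; apply: eq_map => j /=; rewrite (tnth_nth false).
have -> : map val (enum (~: [set j : 'I_N | n <= j]%N)) = map val (enum 'I_n).
  rewrite val_enum_ord {1}/enum_mem -enumT.
  rewrite (eq_filter (a2 := preim val (fun j => j < n)%N)) => [|j]; last first.
    by rewrite !inE -ltnNge.
  rewrite -filter_map val_enum_ord -[N]/((n.+1 + h).+1) addSn -!addnS iotaD filter_cat.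
  rewrite (@eq_in_filter _ _ predT) => [|j]; last by rewrite mem_iota add0n.
  rewrite filter_predT (@eq_in_filter _ _ pred0) ?filter_pred0 ?cats0 // => j.
  by rewrite mem_iota add0n => /andP[le_nj _]; rewrite ltnNge le_nj.
rewrite -map_comp; apply: eq_map => j /=; by rewrite (tnth_nth false).
Qed.

Lemma outcomeE v (y : n.-tuple bool) :
  agrees outcome v && (remaining outcome v == y :> seq bool) =
  (v == put y (setbit [tuple of nseq N false] pwire true)).
Proof.
rewrite remaining_outcome; apply/andP/eqP => [[/forall_inP ag /eqP dv]|->].
  apply: eq_put => [|j le_nj]; first exact: val_inj.
  have := ag j; rewrite postselected_outcome inE le_nj => /(_ isT).
  rewrite tnth_mktuple ltnNge le_nj /= => /eqP[<-].
  by rewrite tnth_setbit -val_eqE /= val_pwire tnth_nseq; case: eqP.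
split; last by rewrite data_put.
apply/forall_inP => j; rewrite postselected_outcome inE => le_nj.
rewrite tnth_mktuple ltnNge le_nj /= put_out // tnth_setbit -val_eqE /= val_pwire tnth_nseq.
by case: (_ == n).
Qed.

(** In the Fourier sum at the selected vector the sign splits into a data character and the phase
    bit. Grouping by data leaves readouts with all ancillas used, and summing them against the
    character is the Hadamard transform of [psi]. *)
Lemma postselect_represents Phi psi : represents h Phi psi ->
  exists2 c : K, c != 0 & postselect n outcome (hadamard_but_last Phi) =
    [ffun y => c * foldr (@hadamard K n) psi (enum 'I_n) y].
Proof.
move=> [c c0 rep].
have s0 k : (sqrtC 2)^-1 ^+ k != 0 :> K.
  by rewrite expf_neq0 // invr_eq0 sqrtC_eq0 pnatr_eq0.
set l := [seq i <- enum 'I_N | i != ord_max].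
have ul : uniq l by rewrite filter_uniq ?enum_uniq.
exists ((sqrtC 2)^-1 ^+ size l * c / (sqrtC 2)^-1 ^+ size (enum 'I_n)) => [|].
  by rewrite !mulf_neq0 ?invr_eq0.
apply/ffunP => y; rewrite !ffunE; under eq_bigl do rewrite outcomeE.
rewrite big_pred1_eq /hadamard_but_last !foldr_hadamardE ?enum_uniq // mulrA mulfVK // -!mulrA.
congr (_ * _); rewrite mulr_sumr.
set x := put y _.
have xm : tnth x ord_max = false.
  by rewrite put_out ?tnth_setbit ?tnth_nseq -?val_eqE ?gtn_eqF ?ltn_pwire_max //=; lia.
(* Outside the data wires, [x] is 1 on the phase wire only. *)
have dotE v : dotl l x v = (dotl (enum 'I_n) y (data v) + tnth v pwire)%N.
  transitivity (\sum_(j < N) (tnth x j && tnth v j))%N.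
    rewrite /dotl big_filter big_enum_cond [RHS](bigD1 ord_max) //= xm add0n.
    exact: eq_bigl.
  rewrite (bigID (fun j : 'I_N => (j < n)%N)) /=; congr (_ + _)%N.
    rewrite (big_ord_narrow data_wire_proof) /dotl big_enum /=; apply: eq_bigr => i _.
    by rewrite put_dwire tnth_data.
  rewrite (bigD1 pwire) ?val_pwire ?ltnn //= big1 ?addn0.
    by rewrite put_out ?val_pwire // tnth_setbit eqxx.
  move=> j /andP[nj /negPf jp]; have -> : tnth x j = false; last by [].
  have le_nj : (n <= j)%N by rewrite leqNgt.
  by rewrite /x (put_out _ _ le_nj) tnth_setbit jp tnth_nseq.
(* Only the last wire has an index of at least [n.+1 + h], and it is also the only wire outside
   [l]. *)
have agE v : agree_off l x v = fresh h [tuple of nseq N false] v.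
  have lE j : (j \notin l) = (j == ord_max) by rewrite mem_filter mem_enum andbT negbK.
  apply/agree_offP/freshP => H j.
    move=> le_j; rewrite H ?lE -?val_eqE /= ?tnth_nseq; last by have := ltn_ord j; lia.
    by have -> : j = ord_max by apply: val_inj => /=; have := ltn_ord j; lia.
  by rewrite lE => /eqP->; rewrite xm H //= tnth_nseq.
rewrite (eq_bigl _ _ agE) (partition_big data xpredT) //=.
rewrite [RHS](eq_bigl xpredT) => [|y']; last first.
  by apply/agree_offP => j; rewrite mem_enum.
apply: eq_bigr => y' _; rewrite mulrCA -(rep y' [tuple of nseq N false]) mulr_sumr.
apply: eq_big => v; first by rewrite andbC.
by move=> /andP[_ /eqP dv]; rewrite dotE dv exprD -mulrA.
Qed.

End Readout.
End Translation.

(** * The compiled circuit and its correctness *)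

Section Compilation.
Variable G : gateset.

Definition hadamards n : qcircuit G n := [seq Had G i | i <- enum 'I_n].

(** The added Hadamards are simulated gates, each using up an ancilla; they cancel those that the
    HC1Q circuit itself applies to the data wires at both ends. *)
Definition conjugated n (U : qcircuit G n) : qcircuit G n :=
  hadamards n ++ U ++ hadamards n.

Definition had_count n (U : qcircuit G n) : nat := count (@is_had G n) (conjugated U).

Definition compile (d : {n : nat & qcircuit G n}) : hc1q_post G :=
  let h := had_count (tagged d) in
  @HC1QPost G ((tag d).+1 + h)
    (clean_phase G (tag d) h ++ translate h 0 (conjugated (tagged d)))
    (outcome (tag d) h).

Lemma had_countE n (U : qcircuit G n) : had_count U = n.*2 + count (@is_had G n) U.
Proof.
have H : count (@is_had G n) (hadamards n) = n.
  by rewrite /hadamards count_map (eq_count (a2 := predT)) // count_predT size_enum_ord.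
rewrite /had_count /conjugated !count_cat H. lia.
Qed.

Variable K : numClosedFieldType.
Local Open Scope ring_scope.

Lemma qrun_hadamards n (l : seq 'I_n) (psi : state K n) :
  qrun [seq Had G i | i <- l] psi = foldl (fun phi i => hadamard i phi) psi l.
Proof. by elim: l psi => //= i l IHl psi; rewrite -IHl. Qed.

(** [foldr] applies the head of [l] last and [foldl] applies it first, so adjacent factors cancel by
    involutivity alone. *)
Lemma foldlr_hadamard n (l : seq 'I_n) (psi : state K n) :
  foldl (fun phi i => hadamard i phi) (foldr (@hadamard K n) psi l) l = psi.
Proof. by elim: l => //= i l IHl; rewrite hadamardK. Qed.

Lemma foldrl_hadamard n (l : seq 'I_n) (psi : state K n) :
  foldr (@hadamard K n) (foldl (fun phi i => hadamard i phi) psi l) l = psi.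
Proof. by elim: l psi => //= i l IHl psi; rewrite IHl hadamardK. Qed.

Lemma compile_correct n (U : qcircuit G n) :
  let f := compile (Tagged (qcircuit G) U) in
  exists2 c : K, c != 0 &
    postselect n (hc_post f) (hc1q_state K (hc_circuit f)) =
    [ffun y => c * qrun U (ket0 K n) y].
Proof.
set h := had_count U.
have rep : represents h _ _ :=
  @represents_translate G n h K 0 (conjugated U) _ _ (leqnn h) (represents_init G n h K).
have [c c0 eq_c] := postselect_represents rep; rewrite apply_fun_comp in eq_c.
exists c => //=; rewrite /hc1q_state /=.
have runE := eq_apply_fun (hadamard_but_last (ket0 K (n.+1 + h).+1))
  (fun x => foldl_cat (fun y g => @cgate_act G _ g y) x (clean_phase G n h)
     (translate h 0 (conjugated U))).
rewrite runE.
rewrite eq_c; apply/ffunP => y; rewrite !ffunE; congr (_ * _).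
rewrite /conjugated /qrun !foldl_cat -!/(qrun _ _) !qrun_hadamards.
by rewrite foldlr_hadamard foldrl_hadamard.
Qed.

End Compilation.

(** * The compiler as a machine program *)

Definition gate_text (c : nat) (ws : seq nat) : seq bool :=
  enc_nat c ++ enc_seq enc_nat ws.

(** Here [k] is the number of the ancilla wire, not the ancilla index that [gadget] takes. *)
Definition gadget_text (n k i : nat) : seq bool :=
  (true :: gate_text 2 [:: i; k; n]) ++ (true :: gate_text 1 [:: i; k]) ++
  (true :: gate_text 1 [:: k; i]).

(** The terminating [false] of [enc_seq] is left out, so that texts of consecutive circuits
    concatenate. *)
Definition circuit_text (G : gateset) N (C : ccircuit G N) : seq bool :=
  flatten [seq true :: enc_cgate g | g <- C].

Section Text.
Variable G : gateset.

Lemma enc_cgateE N (g : cgate G N) :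
  enc_cgate g = gate_text (csym_code (cg_sym g)) [seq val i | i <- cg_wires g].
Proof. by rewrite /enc_cgate /gate_text /enc_seq -map_comp. Qed.

Lemma enc_cnot N (a b : 'I_N) : a != b ->
  enc_cgate (cnot G a b) = gate_text 1 [:: val a; val b].
Proof.
move=> neq; rewrite enc_cgateE /cnot.
case: insubP => [[w u] /= _ /= -> |] //; by rewrite /= inE neq.
Qed.

Lemma enc_toffoli N (a b c : 'I_N) : uniq [:: a; b; c] ->
  enc_cgate (toffoli G a b c) = gate_text 2 [:: val a; val b; val c].
Proof.
move=> un; rewrite enc_cgateE /toffoli.
by case: insubP => [[w u] /= _ /= -> |] //; rewrite un.
Qed.

Lemma enc_lift_gate n h (g : cgate G n) : enc_cgate (lift_gate h g) = enc_cgate g.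
Proof. by rewrite !enc_cgateE /= -map_comp. Qed.

Lemma text_gadget n h k (i : 'I_n) : k <= h ->
  circuit_text (gadget G h k i) = gadget_text n (n.+1 + k) i.
Proof.
move=> le_kh; have Npd := pwireNdwire h i; have Nap := awireNpwire n le_kh.
have Nad := awireNdwire i le_kh.
have Nda : dwire h i != awire n h k by rewrite eq_sym.
have Ndp : dwire h i != pwire n h by rewrite eq_sym.
rewrite /circuit_text /= cats0 enc_toffoli; last by rewrite /= !inE !negb_or Nda Ndp Nap.
by rewrite !enc_cnot //= val_pwire val_awire.
Qed.

Lemma text_clean n h :
  circuit_text (clean_phase G n h) =
  (true :: gate_text 1 [:: n; n.+1 + h]) ++ (true :: gate_text 1 [:: n.+1 + h; n]).
Proof.
have ne : pwire n h != ord_max by rewrite -val_eqE /= val_pwire; lia.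
have ne' : ord_max != pwire n h by rewrite eq_sym.
by rewrite /circuit_text /= cats0 !enc_cnot //= val_pwire.
Qed.

(** The [h.+1] zeros belong to the [h] ancillas and the last wire. *)
Lemma text_outcome n h :
  enc_seq enc_optb (outcome n h) =
  flatten (nseq n [:: true; false]) ++ [:: true; true; true] ++
  flatten (nseq h.+1 [:: true; true; false]) ++ [:: false].
Proof.
have -> : outcome n h = nseq n None ++ Some true :: nseq h.+1 (Some false) :> seq _.
  pose f j := if j < n then None else Some (j == n).
  transitivity [seq f j | j <- iota 0 (n.+1 + h).+1].
    by rewrite -val_enum_ord -map_comp.
  have constE a m k : (forall j, m <= j < m + k -> f j = a) -> map f (iota m k) = nseq k a.
    elim: k m => //= k IHk m H; rewrite H ?IHk // => [j|]; last by lia.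
    by move=> le_j; apply: H; lia.
  rewrite -addnS addSnnS iotaD map_cat (constE None) => [|j /andP[_ lt_jn]]; last first.
    by rewrite /f lt_jn.
  rewrite add0n -[iota n h.+2]/(n :: iota n.+1 h.+1) map_cons (constE (Some false)) => [|j].
    by rewrite /f ltnn eqxx.
  by rewrite /f => /andP[lt_nj _]; rewrite ltnNge (ltnW lt_nj) /= gtn_eqF.
by rewrite /enc_seq map_cat flatten_cat /= !map_nseq -catA.
Qed.

End Text.

(** * Machine routines that write gates *)

Lemma runs_conv p s T s' T' s'' :
  runs p s T s' -> T <= T' -> s' = s'' -> runs p s T' s''.
Proof. by move=> run le_T <-; apply: runs_leq le_T. Qed.

(** Reading a register destroys it, so the number is parked in register 5 and then moved back. *)
Definition copy r o :=
  Seq (While r (Seq (Pop r) (Seq (Push 5 true) (Push o true))))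
      (While 5 (Seq (Pop 5) (Push r true))).

Lemma runs_copy r o s k : s r = nseq k true -> s 5 = [::] ->
    r != o -> r != 5 -> o != 5 ->
  runs (copy r o) s (7 * k + 2) (upd s o (nseq k true ++ s o)).
Proof.
move=> sr s5 nro nr5 no5.
pose s1 j := upd (upd (upd s r (nseq j true)) 5 (nseq (k - j) true)) o (nseq (k - j) true ++ s o).
have r1 : runs (While r (Seq (Pop r) (Seq (Push 5 true) (Push o true)))) (s1 k) (k * 4).+1 (s1 0).
  apply: runs_countdown => [j|j ltjk].
    by rewrite /s1 !updE (negPf nro) (negPf nr5) eqxx.
  have ek : k - j = (k - j.+1).+1 by lia.
  have := runs_seq (runs_pop r (s1 j.+1)) (runs_seq (runs_push 5 true _) (runs_push o true _)).
  congr runs; apply: functional_extensionality => q.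
  rewrite /s1 !updE !eqxx (negPf nro) (negPf nr5) [5 == o]eq_sym [o == r]eq_sym.
  rewrite (negPf nro) (negPf no5).
  rewrite [5 == r]eq_sym (negPf nr5) ek.
  by case: (q =P o) => // _; case: (q =P 5) => // _; case: (q =P r).
pose s2 j := upd (upd (upd s r (nseq (k - j) true)) 5 (nseq j true)) o (nseq k true ++ s o).
have r2 : runs (While 5 (Seq (Pop 5) (Push r true))) (s2 k) (k * 3).+1 (s2 0).
  apply: runs_countdown => [j|j ltjk].
    by rewrite /s2 !updE [5 == o]eq_sym (negPf no5) eqxx.
  have ek : k - j = (k - j.+1).+1 by lia.
  have := runs_seq (runs_pop 5 (s2 j.+1)) (runs_push r true _).
  congr runs; apply: functional_extensionality => q.
  rewrite /s2 !updE !eqxx (negPf nro) (negPf nr5) [5 == o]eq_sym (negPf no5).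
  rewrite ek.
  case: (q =P r) => [->|nqr]; first by rewrite (negPf nro) (negPf nr5).
  by case: (q =P 5) => // ->; rewrite [5 == o]eq_sym (negPf no5).
have e0 : s1 k = s.
  apply: functional_extensionality => q; rewrite /s1 !updE subnn -sr.
  case: (q =P o) => [-> //|_]; case: (q =P 5) => [->|_]; first by rewrite s5.
  by case: (q =P r) => [->|].
have e1 : s1 0 = s2 k by rewrite /s1 /s2 subn0 subnn.
have e2 : s2 0 = upd s o (nseq k true ++ s o).
  apply: functional_extensionality => q; rewrite /s2 !updE subn0 -sr.
  case: (q =P o) => // _; case: (q =P 5) => [->|_]; first by rewrite s5.
  by case: (q =P r) => [->|].
rewrite e0 in r1; rewrite e1 in r1; rewrite e2 in r2.
by apply: runs_leq (runs_seq r1 r2) _; lia.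
Qed.

Fixpoint pushall o (w : seq bool) :=
  if w is b :: w' then Seq (Push o b) (pushall o w') else Skip.

Lemma runs_pushall o w s : runs (pushall o w) s (size w).+1 (upd s o (rev w ++ s o)).
Proof.
elim: w s => [|b w IHw] s /=; first by rewrite upd_same //; apply: runs_skip.
have := runs_seq (runs_push o b s) (IHw _).
by rewrite updE eqxx upd_upd rev_cons cat_rcons.
Qed.

Fixpoint emit_wires (rs : seq nat) :=
  if rs is r :: rs' then
    Seq (Push 1 true) (Seq (copy r 1) (Seq (Push 1 false) (emit_wires rs')))
  else Skip.

(** The text is pushed in reading order and therefore lies reversed in register 1. *)
Definition emit_gate c rs :=
  Seq (pushall 1 (true :: enc_nat c)) (Seq (emit_wires rs) (Push 1 false)).

Definition unary_reg (s : store) B r :=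
  [&& r != 1, r != 5, s r == nseq (size (s r)) true & size (s r) <= B].

Lemma rev_enc_nat k : rev (enc_nat k) = false :: nseq k true.
Proof. by rewrite rev_cat rev_nseq. Qed.

Lemma runs_emit_wires B rs s : s 5 = [::] -> all (unary_reg s B) rs ->
  runs (emit_wires rs) s (size rs * (7 * B + 4)).+1
    (upd s 1 (rev (flatten [seq true :: enc_nat (size (s r)) | r <- rs]) ++ s 1)).
Proof.
elim: rs s => [|r rs IHrs] s s5 /=; first by rewrite upd_same // => _; apply: runs_skip.
case/andP=> /and4P[nr1 nr5 /eqP sr leB] all_rs.
set s' := upd s 1 (false :: nseq (size (s r)) true ++ true :: s 1).
have stable q : q != 1 -> s' q = s q by rewrite /s' updE => /negPf->.
have all' : all (unary_reg s' B) rs.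
  apply: sub_all all_rs => q /and4P[nq1 nq5 eqq leq].
  by rewrite /unary_reg stable // nq1 nq5 eqq leq.
have run' := IHrs s' s5 all'.
have runc : runs (copy r 1) (upd s 1 (true :: s 1)) (7 * size (s r) + 2)
    (upd s 1 (nseq (size (s r)) true ++ true :: s 1)).
  have := @runs_copy r 1 (upd s 1 (true :: s 1)) (size (s r)).
  by rewrite !updE (negPf nr1) !eqxx upd_upd; apply.
have runf : runs (Push 1 false) (upd s 1 (nseq (size (s r)) true ++ true :: s 1)) 1 s'.
  by have := runs_push 1 false (upd s 1 (nseq (size (s r)) true ++ true :: s 1));
     rewrite updE eqxx upd_upd.
apply: runs_conv (runs_seq (runs_push 1 true s) (runs_seq runc (runs_seq runf run'))) _ _.
  by rewrite (mulSn (size rs)); lia.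
rewrite {1 3}/s' upd_upd updE eqxx; congr upd.
rewrite (_ : [seq true :: enc_nat (size (s' q)) | q <- rs] =
             [seq true :: enc_nat (size (s q)) | q <- rs]); last first.
  apply/eq_in_map => q q_rs; rewrite stable //.
  by have /allP/(_ q q_rs)/and4P[] := all_rs.
by rewrite /= rev_cons rev_cat rev_enc_nat cat_rcons -!catA. 
Qed.

Lemma runs_emit_gate c B rs s : s 5 = [::] -> all (unary_reg s B) rs ->
  runs (emit_gate c rs) s (c + 5 + size rs * (7 * B + 4))
    (upd s 1 (rev (true :: gate_text c [seq size (s r) | r <- rs]) ++ s 1)).
Proof.
move=> s5 all_rs.
set s1 := upd s 1 (rev (true :: enc_nat c) ++ s 1).
have all1 : all (unary_reg s1 B) rs.
  apply: sub_all all_rs => q /and4P[nq1 nq5 eqq leq].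
  by rewrite /unary_reg /s1 updE (negPf nq1) nq5 eqq leq.
have runp := runs_pushall 1 (true :: enc_nat c) s.
have runw := @runs_emit_wires B rs s1 s5 all1.
apply: runs_conv (runs_seq runp (runs_seq runw (runs_push 1 false _))) _ _.
  by rewrite /= size_cat size_nseq /=; lia.
rewrite updE eqxx upd_upd /s1 upd_upd updE eqxx -/s1; congr upd.
have -> : [seq true :: enc_nat (size (s1 r)) | r <- rs] =
    [seq true :: enc_nat a | a <- [seq size (s r) | r <- rs]].
  rewrite -map_comp; apply/eq_in_map => q q_rs /=.
  by have /allP/(_ q q_rs)/and4P[nq _ _ _] := all_rs; rewrite /s1 updE (negPf nq).
rewrite /gate_text /enc_seq; set W := flatten _; set E := true :: enc_nat c.
have -> : true :: enc_nat c ++ W ++ [:: false] = (E ++ W) ++ [:: false] by rewrite -catA.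
by rewrite 2!rev_cat -!catA.
Qed.

(** With a store written as [nth] of a list, accesses to concrete registers and updates of them are
    settled by computation. *)
Lemma upd_nth (l : seq (seq bool)) r v : upd (nth [::] l) r v = nth [::] (set_nth [::] l r v).
Proof. by apply: functional_extensionality => q; rewrite nth_set_nth. Qed.

Lemma runs_pushL r b l :
  runs (Push r b) (nth [::] l) 1 (nth [::] (set_nth [::] l r (b :: nth [::] l r))).
Proof. by rewrite -upd_nth; apply: runs_push. Qed.

Lemma runs_popL r l :
  runs (Pop r) (nth [::] l) 1 (nth [::] (set_nth [::] l r (behead (nth [::] l r)))).
Proof. by rewrite -upd_nth; apply: runs_pop. Qed.

Lemma runs_pushallL o w l :
  runs (pushall o w) (nth [::] l) (size w).+1
    (nth [::] (set_nth [::] l o (rev w ++ nth [::] l o))).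
Proof. by rewrite -upd_nth; apply: runs_pushall. Qed.

Lemma runs_while_stop r p s : s r = [::] -> runs (While r p) s 1 s.
Proof. by exists 1; last exact: ExecWhileStop. Qed.

Lemma runs_while_step r p s T s1 T' s2 :
  s r <> [::] -> runs p s T s1 -> runs (While r p) s1 T' s2 ->
  runs (While r p) s (T + T').+1 s2.
Proof.
move=> ne [t le_t ex] [u le_u ex']; exists (t + u).+1; first by rewrite ltnS leq_add.
exact: ExecWhileStep ex ex'.
Qed.

(** * Parsing of encoded sequences *)

(** A loop can only test for emptiness, and the input may continue beyond the sequence; so register
    [fl] holds one bit, popped when the terminating [false] is met. *)
Definition scan fl body :=
  Seq (Push fl true)
    (While fl (Case 0 (Pop fl) (Seq (Pop 0) (Pop fl)) (Seq (Pop 0) body))).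

Section Scan.
Variables (A : Type) (e : A -> seq bool) (fl : nat) (body : prog) (B : nat).
Variable L : seq bool -> seq bool -> seq A -> store.
Hypothesis L0 : forall w f s, L w f s 0 = w.
Hypothesis Lf : forall w f s, L w f s fl = f.
Hypothesis U0 : forall w f s w', upd (L w f s) 0 w' = L w' f s.
Hypothesis Uf : forall w f s f', upd (L w f s) fl f' = L w f' s.

Lemma runs_scan s w :
  (forall s1 a s2 w', s = s1 ++ a :: s2 ->
    runs body (L (e a ++ w') [:: true] s1) B (L w' [:: true] (rcons s1 a))) ->
  runs (scan fl body) (L (enc_seq e s ++ w) [::] [::]) (size s * (B + 3) + 6) (L w [::] s).
Proof.
move=> run_body; have := runs_push fl true (L (enc_seq e s ++ w) [::] [::]).
rewrite Lf Uf => run_fl; suff run_while : forall s2 s1, s = s1 ++ s2 ->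
    runs (While fl (Case 0 (Pop fl) (Seq (Pop 0) (Pop fl)) (Seq (Pop 0) body)))
      (L (enc_seq e s2 ++ w) [:: true] s1) (size s2 * (B + 3) + 5) (L w [::] s).
  by apply: runs_leq (runs_seq run_fl (run_while s [::] erefl)) _; lia.
elim=> [|a s2 IHs2] s1 eq_s.
  rewrite cats0 in eq_s; rewrite -eq_s.
  have ne : L (false :: w) [:: true] s fl <> [::] by rewrite Lf.
  have stop : L w [::] s fl = [::] by rewrite Lf.
  have step : runs (Case 0 (Pop fl) (Seq (Pop 0) (Pop fl)) (Seq (Pop 0) body))
      (L (false :: w) [:: true] s) 3 (L w [::] s).
    apply: runs_case; rewrite L0 /=.
    have := runs_seq (runs_pop 0 (L (false :: w) [:: true] s)) (runs_pop fl _).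
    by rewrite L0 U0 Lf Uf.
  exact: runs_leq (runs_while_step ne step (runs_while_stop _ stop)) _.
set w' := enc_seq e s2 ++ w.
have ew : enc_seq e (a :: s2) ++ w = true :: e a ++ w' by rewrite /w' /enc_seq /= -!catA.
have ne : L (true :: e a ++ w') [:: true] s1 fl <> [::] by rewrite Lf.
have step : runs (Case 0 (Pop fl) (Seq (Pop 0) (Pop fl)) (Seq (Pop 0) body))
    (L (true :: e a ++ w') [:: true] s1) B.+2 (L w' [:: true] (rcons s1 a)).
  apply: runs_case; rewrite L0 /=.
  have := runs_pop 0 (L (true :: e a ++ w') [:: true] s1); rewrite L0 U0 /= => pop0.
  exact: runs_leq (runs_seq pop0 (run_body _ _ _ w' eq_s)) _.
have rest := IHs2 (rcons s1 a); rewrite cat_rcons in rest.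
by rewrite ew; apply: runs_leq (runs_while_step ne step (rest eq_s)) _; rewrite /= mulSn; lia.
Qed.
End Scan.

(** A number in unary is the encoding of a sequence of [k] elements with empty encodings. *)
Lemma runs_scan_nat fl body B (L : seq bool -> seq bool -> nat -> store) k w :
    (forall w f j, L w f j 0 = w) -> (forall w f j, L w f j fl = f) ->
    (forall w f j w', upd (L w f j) 0 w' = L w' f j) ->
    (forall w f j f', upd (L w f j) fl f' = L w f' j) ->
    (forall j w', j < k -> runs body (L w' [:: true] j) B (L w' [:: true] j.+1)) ->
  runs (scan fl body) (L (enc_nat k ++ w) [::] 0) (k * (B + 3) + 6) (L w [::] k).
Proof.
move=> L0 Lf U0 Uf run_body.
have := @runs_scan unit (fun=> [::]) fl body B (fun w f s => L w f (size s)) _ _ _ _ (nseq k tt) w.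
have -> : enc_seq (fun=> [::]) (nseq k tt) = enc_nat k.
  by rewrite /enc_seq /enc_nat; congr cat; elim: (k) => //= j ->.
rewrite size_nseq; apply=> // s1 a s2 w' eq_s.
rewrite size_rcons; apply: run_body; have := congr1 size eq_s.
by rewrite size_nseq size_cat /= => ->; lia.
Qed.

(** Registers: 0 input and final output, 1 reversed gate list, 2 number of data
    wires, 3 next fresh wire, 4 wire index, 5 scratch, 6 countdown,
    7 fresh wires used plus one, 8 to 10 loop flags. *)
Definition lay inp out n k i c m f8 f9 f10 : store :=
  nth [::] [:: inp; out; nseq n true; nseq k true; nseq i true; [::];
               nseq c true; nseq m true; f8; f9; f10].

(** * Programs for gadgets, layers of Hadamards and single gates *)

Definition gadget_prog :=
  Seq (emit_gate 2 [:: 4; 3; 2]) (Seq (emit_gate 1 [:: 4; 3])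
    (Seq (emit_gate 1 [:: 3; 4]) (Seq (Push 3 true) (Push 7 true)))).

Lemma runs_emit_gate_lay g rs B inp out n k i c m f8 f9 f10 :
    n <= B -> k <= B -> i <= B -> all (mem [:: 2; 3; 4]) rs ->
  let s := lay inp out n k i c m f8 f9 f10 in
  runs (emit_gate g rs) s (g + 5 + size rs * (7 * B + 4))
    (lay inp (rev (true :: gate_text g [seq size (s r) | r <- rs]) ++ out) n k i c m f8 f9 f10).
Proof.
move=> le_n le_k le_i all_rs s; have := @runs_emit_gate g B rs s erefl _.
rewrite {3}/s /lay upd_nth; apply; apply: sub_all all_rs => r /=.
by rewrite !inE => /or3P[] /eqP->; rewrite /unary_reg /= !size_nseq eqxx.
Qed.

Lemma runs_gadget B inp out n k i c m f8 f9 f10 : n <= B -> k <= B -> i <= B ->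
  runs gadget_prog (lay inp out n k i c m f8 f9 f10) (49 * B.+1)
    (lay inp (rev (gadget_text n k i) ++ out) n k.+1 i c m.+1 f8 f9 f10).
Proof.
move=> le_n le_k le_i.
have run g rs out' := @runs_emit_gate_lay g rs B inp out' n k i c m f8 f9 f10 le_n le_k le_i.
apply: runs_conv (runs_seq (run 2 [:: 4; 3; 2] out isT) (runs_seq (run 1 [:: 4; 3] _ isT)
  (runs_seq (run 1 [:: 3; 4] _ isT) (runs_seq (runs_pushL 3 true _) (runs_pushL 7 true _))))) _ _.
  by move=> /=; lia.
by rewrite /= !size_nseq /lay /= /gadget_text !rev_cat -!catA.
Qed.

(** Register 6 counts down while register 4 runs through the data wires. The second loop restores
    both, because the layer is written twice and [emit_outcome] needs [n] again. *)
Definition hadamards_prog :=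
  Seq (While 6 (Seq (Pop 6) (Seq gadget_prog (Push 4 true))))
      (While 4 (Seq (Pop 4) (Push 6 true))).

Definition hadamards_text n k j :=
  flatten [seq gadget_text n (k + i) i | i <- iota 0 j].

Lemma runs_hadamards B inp out n k m f8 f9 f10 : k + n <= B ->
  runs hadamards_prog (lay inp out n k 0 n m f8 f9 f10) (60 * B.+1 * B.+1)
    (lay inp (rev (hadamards_text n k n) ++ out) n (k + n) 0 n (m + n) f8 f9 f10).
Proof.
move=> le_B.
pose s1 j := lay inp (rev (hadamards_text n k (n - j)) ++ out) n (k + (n - j)) (n - j) j
  (m + (n - j)) f8 f9 f10.
have run1 : runs (While 6 (Seq (Pop 6) (Seq gadget_prog (Push 4 true)))) (s1 n)
    (n * (49 * B.+1 + 2).+1).+1 (s1 0).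
  apply: runs_countdown => [j|j lt_j]; first by [].
  have ej : n - j = (n - j.+1).+1 by lia.
  pose j' := n - j.+1; pose out' := rev (hadamards_text n k j') ++ out.
  have pop6 : runs (Pop 6) (s1 j.+1) 1 (lay inp out' n (k + j') j' j (m + j') f8 f9 f10).
    exact: runs_popL.
  have gad := @runs_gadget B inp out' n (k + j') j' j (m + j') f8 f9 f10.
  have push4 out'' k' m' : runs (Push 4 true) (lay inp out'' n k' j' j m' f8 f9 f10) 1
      (lay inp out'' n k' j'.+1 j m' f8 f9 f10) by apply: runs_pushL.
  apply: runs_conv (runs_seq pop6 (runs_seq (gad _ _ _) (push4 _ _ _))) _ _;
    rewrite /j'; try lia.
  rewrite /s1 ej !addnS /hadamards_text -[(n - j.+1).+1]addn1 iotaD map_cat flatten_cat.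
  by rewrite rev_cat /= cats0 add0n addn1 catA.
pose s2 j := lay inp (rev (hadamards_text n k n) ++ out) n (k + n) j (n - j) (m + n) f8 f9 f10.
have run2 : runs (While 4 (Seq (Pop 4) (Push 6 true))) (s2 n) (n * 3).+1 (s2 0).
  apply: runs_countdown => [j|j lt_j]; first by [].
  have ej : n - j = (n - j.+1).+1 by lia.
  have := runs_seq (runs_popL 4 _ : runs _ (s2 j.+1) _ _) (runs_pushL 6 true _).
  by rewrite /s2 ej.
have e0 : s1 n = lay inp out n k 0 n m f8 f9 f10 by rewrite /s1 subnn !addn0.
have e1 : s1 0 = s2 n by rewrite /s1 /s2 subnn subn0.
have e2 : s2 0 = lay inp (rev (hadamards_text n k n) ++ out) n (k + n) 0 n (m + n) f8 f9 f10.
  by rewrite /s2 subn0.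
rewrite e0 e1 in run1; rewrite e2 in run2.
by apply: runs_leq (runs_seq run1 run2) _; nia.
Qed.

Definition copy_nat := Seq (scan 10 (Push 1 true)) (Push 1 false).

Lemma runs_copy_nat a w out n k i c m f8 f9 :
  runs copy_nat (lay (enc_nat a ++ w) out n k i c m f8 f9 [::]) (a * 4 + 7)
    (lay w (rev (enc_nat a) ++ out) n k i c m f8 f9 [::]).
Proof.
have run := @runs_scan_nat 10 (Push 1 true) 1
  (fun w f j => lay w (nseq j true ++ out) n k i c m f8 f9 f) a w.
apply: runs_conv (runs_seq (run _ _ _ _ _) (runs_pushL 1 false _)) _ _ => //.
- by move=> w' f j w''; rewrite /lay upd_nth.
- by move=> w' f j w''; rewrite /lay upd_nth.
- by move=> j w' _; apply: runs_pushL.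
- by lia.
by rewrite rev_enc_nat.
Qed.

(** Only delimiters are recognized, never the meaning of the gate code, so one program serves every
    gate set. *)
Definition copy_gate :=
  Seq (Push 1 true) (Seq copy_nat
    (Seq (scan 9 (Seq (Push 1 true) copy_nat)) (Push 1 false))).

Lemma runs_copy_gate B g ws w out n k i c m f8 :
    g <= B -> size ws <= B -> all (fun a => a <= B) ws ->
  runs copy_gate (lay (gate_text g ws ++ w) out n k i c m f8 [::] [::])
    (30 * B.+1 * B.+1)
    (lay w (rev (true :: gate_text g ws) ++ out) n k i c m f8 [::] [::]).
Proof.
move=> le_g le_ws /allP all_ws.
pose pre s := rev (flatten [seq true :: enc_nat a | a <- s]) ++ rev (true :: enc_nat g) ++ out.
have run := @runs_scan nat enc_nat 9 (Seq (Push 1 true) copy_nat) (B * 4 + 8)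
  (fun w f s => lay w (pre s) n k i c m f8 f [::]) _ _ _ _ ws w.
have push1 : runs (Push 1 true) (lay (gate_text g ws ++ w) out n k i c m f8 [::] [::]) 1
    (lay (gate_text g ws ++ w) (true :: out) n k i c m f8 [::] [::]) by apply: runs_pushL.
have copy1 := runs_copy_nat g (enc_seq enc_nat ws ++ w) (true :: out) n k i c m f8 [::].
have e1 : lay (enc_seq enc_nat ws ++ w) (rev (enc_nat g) ++ true :: out) n k i c m f8 [::] [::]
   = lay (enc_seq enc_nat ws ++ w) (pre [::]) n k i c m f8 [::] [::].
  by rewrite /pre rev_cons cat_rcons.
have e2 : gate_text g ws ++ w = enc_nat g ++ (enc_seq enc_nat ws ++ w) by rewrite catA.
rewrite e1 -e2 in copy1.
apply: runs_conv (runs_seq push1 (runs_seq copy1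
  (runs_seq (run _ _ _ _ _) (runs_pushL 1 false _)))) _ _ => //.
- by move=> w' f s w''; rewrite /lay upd_nth.
- by move=> w' f s w''; rewrite /lay upd_nth.
- move=> s1 a s2 w' eq_ws.
  have push2 : runs (Push 1 true) (lay (enc_nat a ++ w') (pre s1) n k i c m f8 [:: true] [::]) 1
    (lay (enc_nat a ++ w') (true :: pre s1) n k i c m f8 [:: true] [::]) by apply: runs_pushL.
  have le_a : a <= B by apply: all_ws; rewrite eq_ws mem_cat inE eqxx orbT.
  apply: runs_conv (runs_seq push2 (runs_copy_nat _ _ _ _ _ _ _ _ _ _)) _ _; first by lia.
  congr lay.
  by rewrite /pre map_rcons flatten_rcons rev_cat [rev (true :: enc_nat a)]rev_cons -catA cat_rcons.
- by nia.
rewrite /pre /gate_text /enc_seq; set W := flatten _; set E := true :: enc_nat g.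
have -> : true :: enc_nat g ++ W ++ [:: false] = (E ++ W) ++ [:: false] by rewrite -catA.
by rewrite 2!rev_cat -!catA.
Qed.

Definition gate_prog :=
  Case 0 Skip
    (Seq (Pop 0) (Seq (scan 10 (Push 4 true)) (Seq gadget_prog (clear 4))))
    (Seq (Pop 0) copy_gate).

Lemma size_enc_seq (T : Type) (e : T -> seq bool) s :
  size (enc_seq e s) = (\sum_(a <- s) (size (e a)).+1).+1.
Proof.
rewrite /enc_seq size_cat addn1; congr _.+1.
by elim: s => [|a s IHs]; rewrite ?big_nil //= size_cat IHs big_cons addSn.
Qed.

Lemma leq_size_enc_seq (T : Type) (e : T -> seq bool) s : size s <= size (enc_seq e s).
Proof. by rewrite size_enc_seq; elim: s => //= a s IHs; rewrite big_cons; lia. Qed.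

Lemma all_enc_seq (T : Type) (e : T -> seq bool) B s :
  size (enc_seq e s) <= B -> all (fun a => size (e a) <= B) s.
Proof.
rewrite size_enc_seq; elim: s => //= a s IHs; rewrite big_cons => le_B.
by apply/andP; split; [lia | apply: IHs; lia].
Qed.

Lemma size_enc_nat a : size (enc_nat a) = a.+1.
Proof. by rewrite size_cat size_nseq addn1. Qed.

Lemma gate_text_bounds B g ws : size (gate_text g ws) <= B ->
  [/\ g <= B, size ws <= B & all (fun a => a <= B) ws].
Proof.
rewrite size_cat size_enc_nat => le_B; have le_ws := leq_size_enc_seq enc_nat ws.
split; first by lia.
  by lia.
have le_B' : size (enc_seq enc_nat ws) <= B by lia.
by apply: sub_all (all_enc_seq le_B') => a; rewrite size_enc_nat => /ltnW.
Qed.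

Section GateScan.
Variables (G : gateset) (n h : nat).

Lemma translate_cat k (U V : qcircuit G n) :
  translate h k (U ++ V) =
  translate h k U ++ translate h (k + count (@is_had G n) U) V.
Proof.
elim: U k => [|[i|g] U IHU] k /=; first by rewrite addn0.
  by rewrite IHU addnA addn1.
by rewrite IHU add0n.
Qed.

Lemma circuit_text_cat N (C D : ccircuit G N) :
  circuit_text (C ++ D) = circuit_text C ++ circuit_text D.
Proof. by rewrite /circuit_text map_cat flatten_cat. Qed.

Lemma runs_gate B (g : qgate G n) k w out c m :
    size (enc_qgate g) <= B -> n.+1 + k <= B -> k + is_had g <= h ->
  runs gate_prog (lay (enc_qgate g ++ w) out n (n.+1 + k) 0 c m [:: true] [::] [::])
    (100 * B.+1 * B.+1)
    (lay w (rev (circuit_text (translate h k [:: g])) ++ out) n (n.+1 + k + is_had g) 0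
       c (m + is_had g) [:: true] [::] [::]).
Proof.
case: g => [i|g] le_g le_k le_h.
  have {}le_g : i < B by move: le_g; rewrite /= size_enc_nat => /ltnW.
  set s0 := lay _ _ _ _ _ _ _ _ _ _.
  have pop0 : runs (Pop 0) s0 1
    (lay (enc_nat i ++ w) out n (n.+1 + k) 0 c m [:: true] [::] [::]).
    by have := runs_pop 0 s0; rewrite /s0 /lay upd_nth.
  have scn : runs (scan 10 (Push 4 true))
      (lay (enc_nat i ++ w) out n (n.+1 + k) 0 c m [:: true] [::] [::]) (i * (1 + 3) + 6)
      (lay w out n (n.+1 + k) i c m [:: true] [::] [::]).
    apply: (@runs_scan_nat _ _ _ (fun w f j => lay w out n (n.+1 + k) j c m [:: true] [::] f)) => //.
    - by move=> w' f j w''; rewrite /lay upd_nth.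
    - by move=> w' f j w''; rewrite /lay upd_nth.
    - by move=> j w' _; apply: runs_pushL.
  have gad := @runs_gadget B w out n (n.+1 + k) i c m [:: true] [::] [::] _ _ _.
  have clr s := runs_clear 4 s.
  have run : runs (Seq (Pop 0) (Seq (scan 10 (Push 4 true)) (Seq gadget_prog (clear 4)))) s0 _ _ :=
    runs_seq pop0 (runs_seq scn (runs_seq (gad _ _ _) (clr _))).
  apply: runs_conv (runs_case (_ : runs _ s0 _ _)) _ _; first by apply: run; lia.
    by rewrite /= size_nseq; nia.
  rewrite (@text_gadget G n h k i) ?addn1; last by move: le_h => /=; lia.
  by rewrite /lay upd_nth.
set s0 := lay _ _ _ _ _ _ _ _ _ _.
have pop0 : runs (Pop 0) s0 1
  (lay (enc_cgate g ++ w) out n (n.+1 + k) 0 c m [:: true] [::] [::]).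
    by have := runs_pop 0 s0; rewrite /s0 /lay upd_nth.
have [] := @gate_text_bounds B (csym_code (cg_sym g)) [seq val i | i <- cg_wires g].
  by move: le_g; rewrite /= -enc_cgateE; lia.
move=> h1 h2 h3; have := @runs_copy_gate B _ _ w out n (n.+1 + k) 0 c m [:: true] h1 h2 h3.
rewrite -enc_cgateE => copy1; apply: runs_conv (runs_case (_ : runs _ s0 _ _)) _ _.
- exact: runs_seq pop0 copy1.
- by nia.
by rewrite /circuit_text /= enc_lift_gate cats0 !addn0.
Qed.

(** The loop invariant: after a prefix of the circuit, registers 3 and 7 have advanced by its number
    of Hadamards. *)
Lemma runs_gates B (U : qcircuit G n) k w out c :
    all (fun g => size (enc_qgate g) <= B) U -> n.+1 + h <= B -> k + count (@is_had G n) U <= h ->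
  runs (scan 8 gate_prog)
    (lay (enc_seq (@enc_qgate G n) U ++ w) out n (n.+1 + k) 0 c k.+1 [::] [::] [::])
    (size U * (100 * B.+1 * B.+1 + 3) + 6)
    (lay w (rev (circuit_text (translate h k U)) ++ out) n (n.+1 + k + count (@is_had G n) U) 0 c
       (k.+1 + count (@is_had G n) U) [::] [::] [::]).
Proof.
move=> all_U le_B le_h.
have := @runs_scan _ (@enc_qgate G n) 8 gate_prog (100 * B.+1 * B.+1) (fun w f s =>
  lay w (rev (circuit_text (translate h k s)) ++ out) n (n.+1 + k + count (@is_had G n) s) 0 c
       (k.+1 + count (@is_had G n) s) f [::] [::]) _ _ _ _ U w.
rewrite /= !addn0; apply=> //.
- by move=> w' f s w''; rewrite /lay upd_nth.
- by move=> w' f s w''; rewrite /lay upd_nth.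
move=> s1 g s2 w' eq_U; rewrite -cats1 translate_cat circuit_text_cat rev_cat -catA.
rewrite count_cat /= addn0 !addnA -[n.+1 + k + _]addnA.
move: le_h all_U; rewrite eq_U count_cat all_cat /= => le_h /and3P[_ le_g _].
by apply: runs_gate; lia.
Qed.

Lemma text_hadamards k : k + n <= h ->
  circuit_text (translate h k (hadamards G n)) = hadamards_text n (n.+1 + k) n.
Proof.
move=> le_h; rewrite /hadamards /hadamards_text -val_enum_ord -[in RHS]map_comp.
(* Generalization to a segment of the enumeration starting at [j], along which data wire and ancilla
   advance together. *)
suff H (s : seq 'I_n) j : k + j + size s <= h -> (forall i, i < size s -> nth 0 (map val s) i = j + i) ->
   circuit_text (translate h (k + j) [seq Had G i | i <- s]) =
   flatten [seq gadget_text n (n.+1 + k + val i) (val i) | i <- s].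
  rewrite -[in LHS](addn0 k) (H _ 0) ?addn0 ?size_enum_ord //.
  by move=> i lt_i; rewrite val_enum_ord nth_iota.
elim: s j => [|i s IHs] j // le_j nthE.
have ei : i = j :> nat by have := nthE 0 isT; rewrite /= addn0.
rewrite -[translate _ _ _]/(gadget G h (k + j) i ++ translate h (k + j).+1 [seq Had G i | i <- s]).
rewrite circuit_text_cat text_gadget; last by move: le_j => /=; lia.
rewrite -[RHS]/(gadget_text n (n.+1 + k + val i) (val i) ++
  flatten [seq gadget_text n (n.+1 + k + val i0) (val i0) | i0 <- s]).
congr (_ ++ _); first by rewrite -ei addnA.
rewrite -(IHs j.+1) => [||i' lt_i]; first by rewrite addnS.
  by move: le_j => /=; lia.
by have := nthE i'.+1 lt_i; rewrite /= addnS.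
Qed.
End GateScan.

(** * Header, postselection pattern and assembly of the output *)

(** Register 3 starts at [n.+1], the first ancilla. Register 7 starts at one so as to count the last
    wire, which is postselected on 0 like the ancillas. *)
Definition parse_width :=
  Seq (scan 10 (Seq (Push 2 true) (Seq (Push 6 true) (Push 3 true))))
    (Seq (Push 3 true) (Push 7 true)).

Lemma init_lay w : init w = lay w [::] 0 0 0 0 0 [::] [::] [::].
Proof.
apply: functional_extensionality => q; rewrite /init /lay updE.
by do 11 (case: q => [|q] //); rewrite /= nth_nil.
Qed.

Lemma runs_parse_width n w :
  runs parse_width (init (enc_nat n ++ w)) (n * 6 + 8)
    (lay w [::] n n.+1 0 n 1 [::] [::] [::]).
Proof.
rewrite init_lay.
have run : runs (scan 10 (Seq (Push 2 true) (Seq (Push 6 true) (Push 3 true))))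
    (lay (enc_nat n ++ w) [::] 0 0 0 0 0 [::] [::] [::]) (n * (3 + 3) + 6)
    (lay w [::] n n 0 n 0 [::] [::] [::]).
  apply: (@runs_scan_nat _ _ _ (fun w f j => lay w [::] j j 0 j 0 [::] [::] f)) => //.
  - by move=> w' f j w''; rewrite /lay upd_nth.
  - by move=> w' f j w''; rewrite /lay upd_nth.
  move=> j w' _.
  exact: (runs_seq (runs_pushL 2 true _) (runs_seq (runs_pushL 6 true _) (runs_pushL 3 true _))).
by apply: runs_conv (runs_seq run (runs_seq (runs_pushL 3 true _) (runs_pushL 7 true _))) _ _;
   first by lia.
Qed.

(** The consumed input has left register 0 empty; the pattern is pushed there back to front, from
    the terminator to the data wires. *)
Definition emit_outcome :=
  Seq (pushall 0 [:: false])
    (Seq (While 7 (Seq (Pop 7) (pushall 0 [:: false; true; true])))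
      (Seq (pushall 0 [:: true; true; true])
        (While 6 (Seq (Pop 6) (pushall 0 [:: false; true]))))).

Lemma runs_emit_outcome out n k m :
  runs emit_outcome (lay [::] out n k 0 n m [::] [::] [::]) (m * 6 + n * 5 + 8)
    (lay (flatten (nseq n [:: true; false]) ++ [:: true; true; true] ++
          flatten (nseq m [:: true; true; false]) ++ [:: false])
      out n k 0 0 0 [::] [::] [::]).
Proof.
have flattenS (w : seq bool) j : flatten (nseq j.+1 w) = w ++ flatten (nseq j w) by [].
set P1 := [:: true; true; false]; set P2 := [:: true; false].
pose s1 j := lay (flatten (nseq (m - j) P1) ++ [:: false]) out n k 0 n j [::] [::] [::].
have run1 : runs (While 7 (Seq (Pop 7) (pushall 0 [:: false; true; true]))) (s1 m)
    (m * 6).+1 (s1 0).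
  apply: runs_countdown => [j|j lt_j] //.
  have ej : m - j = (m - j.+1).+1 by lia.
  have := runs_seq (runs_popL 7 _ : runs _ (s1 j.+1) _ _) (runs_pushallL 0 [:: false; true; true] _).
  by rewrite /s1 ej flattenS -catA.
set w1 := [:: true; true; true] ++ flatten (nseq m P1) ++ [:: false].
pose s2 j := lay (flatten (nseq (n - j) P2) ++ w1) out n k 0 j 0 [::] [::] [::].
have run2 : runs (While 6 (Seq (Pop 6) (pushall 0 [:: false; true]))) (s2 n)
    (n * 5).+1 (s2 0).
  apply: runs_countdown => [j|j lt_j] //.
  have ej : n - j = (n - j.+1).+1 by lia.
  have := runs_seq (runs_popL 6 _ : runs _ (s2 j.+1) _ _) (runs_pushallL 0 [:: false; true] _).
  by rewrite /s2 ej flattenS -catA.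
have push0 : runs (pushall 0 [:: false]) (lay [::] out n k 0 n m [::] [::] [::]) 2 (s1 m).
  by rewrite /s1 subnn; apply: runs_pushallL.
have push3 : runs (pushall 0 [:: true; true; true]) (s1 0) 4 (s2 n).
  by rewrite /s1 /s2 subnn subn0; apply: runs_pushallL.
apply: runs_conv (runs_seq push0 (runs_seq run1 (runs_seq push3 run2))) _ _; first by lia.
by rewrite /s2 subn0.
Qed.

Definition reverse_onto_output :=
  While 1 (Case 1 Skip (Seq (Pop 1) (Push 0 false)) (Seq (Pop 1) (Push 0 true))).

Lemma runs_reverse_onto_output w out n k i c m f8 f9 f10 :
  runs reverse_onto_output (lay w out n k i c m f8 f9 f10) (size out * 4).+1
    (lay (rev out ++ w) [::] n k i c m f8 f9 f10).
Proof.
elim: out w => [|b out IHout] w; first exact: runs_while_stop.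
have step : runs (Case 1 Skip (Seq (Pop 1) (Push 0 false)) (Seq (Pop 1) (Push 0 true)))
    (lay w (b :: out) n k i c m f8 f9 f10) 3 (lay (b :: w) out n k i c m f8 f9 f10).
  by apply: runs_case; case: b; apply: runs_seq (runs_popL 1 _) (runs_pushL 0 _ _).
apply: runs_conv (runs_while_step _ step (IHout (b :: w))) _ _ => //.
by rewrite rev_cons cat_rcons.
Qed.

(** The text is built back to front: the first two bits pushed close the wire list and the number of
    the second wire. *)
Definition push_cnot a b :=
  Seq (pushall 0 [:: false; false]) (Seq (copy b 0) (Seq (pushall 0 [:: true; false])
    (Seq (copy a 0) (pushall 0 [:: true; false; true; true])))).

Lemma runs_copy_lay r w out n k m (v := if r == 2 then n else k) : r \in [:: 2; 3] ->
  runs (copy r 0) (lay w out n k 0 0 m [::] [::] [::]) (7 * v + 2)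
    (lay (nseq v true ++ w) out n k 0 0 m [::] [::] [::]).
Proof.
rewrite /v !inE => /orP[] /eqP-> /=.
  have := @runs_copy 2 0 (lay w out n k 0 0 m [::] [::] [::]) n.
  by rewrite /lay upd_nth; apply.
have := @runs_copy 3 0 (lay w out n k 0 0 m [::] [::] [::]) k.
by rewrite /lay upd_nth; apply.
Qed.

Lemma runs_push_cnot a b w out n k m : a \in [:: 2; 3] -> b \in [:: 2; 3] ->
  let v r := if r == 2 then n else k in
  runs (push_cnot a b) (lay w out n k 0 0 m [::] [::] [::]) (7 * v a + 7 * v b + 15)
    (lay ((true :: gate_text 1 [:: v a; v b]) ++ w) out n k 0 0 m [::] [::] [::]).
Proof.
move=> a23 b23 v; have copyE r w' := @runs_copy_lay r w' out n k m.
have pushE u w' : runs (pushall 0 u) (lay w' out n k 0 0 m [::] [::] [::]) (size u).+1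
    (lay (rev u ++ w') out n k 0 0 m [::] [::] [::]) by apply: runs_pushallL.
apply: runs_conv (runs_seq (pushE _ _) (runs_seq (copyE b _ b23) (runs_seq (pushE _ _)
  (runs_seq (copyE a _ a23) (pushE _ _))))) _ _.
  by rewrite -/(v a) -/(v b); move: (v a) (v b) => p q /=; lia.
by rewrite /gate_text /enc_seq /= -!catA /= -!catA.
Qed.

(** The qubit count and the two cleaning gates stand first in the output but mention the last wire,
    whose number is known only after all Hadamards are counted. They are therefore prepended at the
    end, the second cleaning gate before the first. *)
Definition compiler :=
  Seq (Seq parse_width (Seq hadamards_prog (Seq (scan 8 gate_prog)
    (Seq hadamards_prog (Push 1 false)))))
  (Seq emit_outcome (Seq reverse_onto_output
    (Seq (push_cnot 3 2) (Seq (push_cnot 2 3)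
      (Seq (Push 0 false) (Seq (copy 3 0) (Push 0 true))))))).

Lemma leq_size_enc_qcircuit (G : gateset) (n : nat) (U : qcircuit G n) :
  let D := size (enc_qcircuit (Tagged (qcircuit G) U)) in
  [/\ n <= D, size U <= D & all (fun g => size (enc_qgate g) <= D) U].
Proof.
move=> D; rewrite /D /enc_qcircuit /= size_cat size_enc_nat.
have le_U := leq_size_enc_seq (@enc_qgate G n) U; split; try lia.
by apply: all_enc_seq; apply: leq_addl.
Qed.

Lemma enc_compile (G : gateset) n (U : qcircuit G n) (h := had_count U) :
  enc_hc1q (compile (Tagged (qcircuit G) U)) =
  enc_nat (n.+1 + h).+1 ++ circuit_text (clean_phase G n h) ++
  (circuit_text (translate h 0 (conjugated U)) ++ [:: false]) ++
  enc_seq enc_optb (outcome n h).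
Proof.
have encE (C D : ccircuit G (n.+1 + h).+1) (w : seq bool) :
    enc_seq (@enc_cgate G _) (C ++ D) ++ w =
    circuit_text C ++ (circuit_text D ++ [:: false]) ++ w.
  by rewrite /enc_seq map_cat flatten_cat -!catA.
by rewrite -encE.
Qed.

(** The scan dominates, with [q] gates at quadratic cost each; once the products are bounded
    separately, the rest is linear. *)
Lemma compiler_time p q r : 0 < r -> p <= r -> q <= r ->
  p * 6 + 8 + (60 * r * r + (q * (100 * r * r + 3) + 6 + (60 * r * r + 1)))
    <= 300 * (r * r * r).
Proof.
move=> r_gt0 le_p le_q.
have le1 : r <= r * r by rewrite leq_pmull.
have le2 : r * r <= r * r * r by rewrite leq_pmulr.
have le3 : q * (100 * r * r + 3) <= r * (100 * r * r + 3) by rewrite leq_mul2r le_q orbT.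
have e : r * (100 * r * r + 3) = 100 * (r * r * r) + 3 * r by ring.
have e' : 60 * r * r = 60 * (r * r) by ring.
by rewrite e in le3; rewrite e'; lia.
Qed.

Lemma compiler_correct (G : gateset) (d : {n : nat & qcircuit G n}) :
  let b := 4 * size (enc_qcircuit d) + 5 in
  exists2 s, runs compiler (init (enc_qcircuit d)) (2000 * (b * b * b)) s
    & s 0 = enc_hc1q (compile d).
Proof.
case: d => n U; set D := size _ => b.
have [le_n le_U all_U] := leq_size_enc_qcircuit U; rewrite -/D in le_n le_U all_U.
pose h := had_count U; have hE : h = n.*2 + count (@is_had G n) U := had_countE U.
have le_count := count_size (@is_had G n) U.
(* [n.+1 + h] equals [3 * n + 1] plus the number of Hadamards in [U], and both [n] and that number
   are at most [D]. *)
pose B := 4 * D + 4; have le_B : n.+1 + h <= B by rewrite /B; lia.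
have {}all_U : all (fun g => size (enc_qgate g) <= B) U.
  by apply: sub_all all_U => g /leq_trans; apply; rewrite /B; lia.
set w := enc_seq (@enc_qgate G n) U.
set X1 := circuit_text (translate h 0 (hadamards G n)).
set X2 := circuit_text (translate h n U).
set X3 := circuit_text (translate h (n + count (@is_had G n) U) (hadamards G n)).
have X1E : hadamards_text n n.+1 n = X1 by rewrite /X1 text_hadamards ?addn0 //; lia.
have X3E : hadamards_text n (n.+1 + n + count (@is_had G n) U) n = X3.
  by rewrite /X3 text_hadamards ?addnA //; lia.
have run1 := runs_parse_width n w.
set out1 := rev X1 ++ [::].
have run2 := @runs_hadamards B w [::] n n.+1 1 [::] [::] [::].
have run3 := @runs_gates G n h B U n [::] out1 n all_U le_B.
have run4 := @runs_hadamards B [::] (rev X2 ++ out1) n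
  (n.+1 + n + count (@is_had G n) U) (n.+1 + count (@is_had G n) U) [::] [::] [::].
rewrite X1E add1n -/out1 in run2; rewrite X3E in run4; rewrite cats0 -/X2 in run3.
set out := rev X3 ++ rev X2 ++ out1 in run4.
have eK : n.+1 + n + count (@is_had G n) U + n = n.+1 + h by rewrite hE -addnn; lia.
have eM : n.+1 + count (@is_had G n) U + n = h.+1 by rewrite hE -addnn; lia.
rewrite eK eM in run4.
have run5 : runs (Push 1 false) (lay [::] out n (n.+1 + h) 0 n h.+1 [::] [::] [::]) 1
   (lay [::] (false :: out) n (n.+1 + h) 0 n h.+1 [::] [::] [::]) by apply: runs_pushL.
have c2 : n.+1 + n <= B by lia.
have c3 : n + count (@is_had G n) U <= h by lia.
have runA := runs_seq run1 (runs_seq (run2 c2) (runs_seq (run3 c3) (runs_seq (run4 le_B) run5))).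
have eb : B.+1 = b by rewrite /B /b; lia.
have le_nB : n <= B.+1 by rewrite /B; lia.
have le_UB : size U <= B.+1 by rewrite /B; lia.
have {}runA := runs_leq runA (@compiler_time n (size U) B.+1 isT le_nB le_UB).
rewrite eb in runA; set R := 300 * _ in runA.
(* The text in register 1 is no longer than the time spent so far, so its length need not be
   computed. *)
have le_out : (size out).+1 <= R.
  have [t le_t /(exec_size 1)] := runA.
  by rewrite init_lay /= => /leq_trans; apply.
have runB := runs_emit_outcome (false :: out) n (n.+1 + h) h.+1.
set post := flatten (nseq n [:: true; false]) ++ _ in runB.
have runC := runs_reverse_onto_output post (false :: out) n (n.+1 + h) 0 0 0 [::] [::] [::].
set body := rev (false :: out) ++ post in runC.
have runD w' := @runs_push_cnot 3 2 w' [::] n (n.+1 + h) 0 isT isT.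
have runE w' := @runs_push_cnot 2 3 w' [::] n (n.+1 + h) 0 isT isT.
have pushE bit w' : runs (Push 0 bit) (lay w' [::] n (n.+1 + h) 0 0 0 [::] [::] [::]) 1
    (lay (bit :: w') [::] n (n.+1 + h) 0 0 0 [::] [::] [::]) by apply: runs_pushL.
have copyE w' := @runs_copy_lay 3 w' [::] n (n.+1 + h) 0 isT.
have run := runs_seq runA (runs_seq runB (runs_seq runC (runs_seq (runD _) (runs_seq (runE _)
  (runs_seq (pushE false _) (runs_seq (copyE _) (pushE true _))))))).
eexists.
  apply: runs_leq run _.
  have le_nb : n <= b by rewrite -eb; lia.
  have le_hb : n.+1 + h <= b by rewrite -eb; lia.
  have le_b3 : b <= b * b * b by rewrite leq_pmull // /b; lia.
  have le_hb' : h.+1 <= b by lia.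
  rewrite /R in le_out *; clear -le_out le_nb le_hb le_hb' le_b3.
  move: le_out; rewrite /=; move: (size out) (b * b * b) le_b3 => o b3 le_b3 le_out.
  by clear -le_out le_nb le_hb le_hb' le_b3; lia.
have count_had : count (@is_had G n) (hadamards G n) = n.
  by rewrite /hadamards count_map (eq_count (a2 := predT)) // count_predT size_enum_ord.
have textE : circuit_text (translate h 0 (conjugated U)) = X1 ++ X2 ++ X3.
  by rewrite /conjugated !translate_cat count_had !circuit_text_cat add0n.
have bodyE : body = (X1 ++ X2 ++ X3 ++ [:: false]) ++ post.
  by rewrite /body /out /out1 cats0 rev_cons !rev_cat !revK -cats1 -!catA.
rewrite enc_compile text_clean text_outcome textE bodyE -/post.
by rewrite /lay /gate_text /enc_seq /enc_nat /= -/h -!catA /= -!catA /= -!catA.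
Qed.

Lemma polytime_compile (G : gateset) :
  polytime (@enc_qcircuit G) (@enc_hc1q G) (@compile G).
Proof.
apply/polytimeP; exists compiler.
exists (fun L => 2000 * ((4 * L + 5) * (4 * L + 5) * (4 * L + 5))); split; last first.
  by move=> d; apply: compiler_correct.
have lin : polyb (fun L => 4 * L + 5).
  exact: polyb_add (polyb_mul (polyb_const 4) polyb_id) (polyb_const 5).
exact: polyb_mul (polyb_const _) (polyb_mul (polyb_mul lin lin) lin).
Qed.

Theorem theorem3 (K : numClosedFieldType) (G : gateset) :
  exists F : {n : nat & qcircuit G n} -> hc1q_post G,
    [/\ polytime (@enc_qcircuit G) (@enc_hc1q G) F,
        exists c k : nat, forall (n : nat) (U : qcircuit G n),
          hc_qubits (F (Tagged (qcircuit G) U)) <= c * (n + size U) ^ k + c,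
        forall (n : nat) (U : qcircuit G n),
          let h := F (Tagged (qcircuit G) U) in
          #|postselected (hc_post h)| + n = hc_qubits h /\
          exists2 c : K, (c != 0)%R &
            postselect n (hc_post h) (hc1q_state K (hc_circuit h)) =
            [ffun y => (c * qrun U (ket0 K n) y)%R]
      & forall U : (forall n : nat, qcircuit G n),
          polytime unary (@enc_qcircuit G)
            (fun n => Tagged (qcircuit G) (U n)) ->
          polytime unary (@enc_hc1q G)
            (fun n => F (Tagged (qcircuit G) (U n))) /\
          exists c k : nat, forall n : nat,
            hc_qubits (F (Tagged (qcircuit G) (U n))) <= c * n ^ k + c].
Proof.
exists (@compile G); split.
- exact: polytime_compile.
(* The qubit number is [3 * n + 2] plus the number of Hadamards in [U], which is at most
   [size U]. *)
- exists 3, 1 => n U; rewrite /hc_qubits /= had_countE expn1.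
  by have := count_size (@is_had G n) U; lia.
- by move=> n U; split; [apply: card_postselected | apply: compile_correct].
move=> U polyU; have poly := polytime_comp polyU (polytime_compile G); split=> //.
(* The output contains the number of qubits in unary, so its polynomial length bounds that
   number. *)
have [c [k le_c]] := polytime_size poly; exists c, k => n.
have := le_c n; rewrite size_nseq; apply: leq_trans.
by rewrite /enc_hc1q size_cat size_enc_nat leqW // leq_addr.
Qed.
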